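(* Let $K$ be a field, let $\mathbb{X}\subseteq\mathbb{P}^n_K$ be a $0$-dimensional locally Gorenstein scheme with no point of $\mathrm{Supp}(\mathbb{X})$ on the hyperplane $X_0=0$, let $0\le d\le r_{\mathbb{X}}-1$, and let $\sigma$ be a homogeneous trace map of degree zero of $Q^h(R)/L_0$. If $\mathbb{X}$ has CBP($d$), then $\mathrm{HF}_{\delta^\sigma_{\mathbb{X}}}(d)=0$.
   Context: Setting. $P=K[X_0,\dots,X_n]$ has the standard grading, $I_{\mathbb{X}}\subseteq P$ is the (saturated) homogeneous vanishing ideal of $\mathbb{X}$, $R=P/I_{\mathbb{X}}$, and $\mathrm{Supp}(\mathbb{X})=\{p_1,\dots,p_s\}$ is the set of closed points. The residue class $x_0$ of $X_0$ in $R$ is a non-zerodivisor. $\mathcal{O}_{\mathbb{X},p_j}$ is the local ring at $p_j$, with residue field $\kappa(p_j)$; $\varkappa_j=\dim_K\kappa(p_j)$; $\deg(\mathbb{X})=\sum_j\dim_K\mathcal{O}_{\mathbb{X},p_j}$. For a graded module $M$, $\mathrm{HF}_M(i)=\dim_KM_i$; $\mathrm{HF}_{\mathbb{X}}=\mathrm{HF}_R$; $r_{\mathbb{X}}$ is the least integer such that $\mathrm{HF}_{\mathbb{X}}(i)=\deg(\mathbb{X})$ for all $i\ge r_{\mathbb{X}}$. $\mathbb{X}$ is locally Gorenstein if every $\mathcal{O}_{\mathbb{X},p_j}$ is a Gorenstein ring. $Q^h(R)$ is the localization of $R$ at all homogeneous non-zerodivisors; $Q^h(R)=R_{x_0}\cong\prod_{j=1}^s\mathcal{O}_{\mathbb{X},p_j}[T_j,T_j^{-1}]$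 with $\deg T_j=1$, via the injection $\tilde\imath:R\to Q^h(R)$, $\tilde\imath(f)=(f_{p_1}T_1^i,\dots,f_{p_s}T_s^i)$ for $f\in R_i$, where $f_{p_j}$ is the germ of $f$ at $p_j$ (the image of $f/x_0^i$ in $\mathcal{O}_{\mathbb{X},p_j}$). Cayley-Bacharach. A subscheme $\mathbb{Y}\subseteq\mathbb{X}$ is a $p_j$-subscheme if $\mathcal{O}_{\mathbb{Y},p_k}=\mathcal{O}_{\mathbb{X},p_k}$ for $k\ne j$ and $\mathcal{O}_{\mathbb{X},p_j}\to\mathcal{O}_{\mathbb{Y},p_j}$ is surjective; it is maximal if $\deg(\mathbb{Y})=\deg(\mathbb{X})-\varkappa_j$. Maximal $p_j$-subschemes correspond bijectively to the ideals $\langle s_j\rangle$ of $\mathcal{O}_{\mathbb{X},p_j}$ generated by a nonzero socle element $s_j$ (with $\mathcal{O}_{\mathbb{Y},p_j}=\mathcal{O}_{\mathbb{X},p_j}/\langle s_j\rangle$). For $a\in\mathcal{O}_{\mathbb{X},p_j}$ put $\mu(a)=\min\{i\in\mathbb{N}\mid(0,\dots,0,aT_j^i,0,\dots,0)\in\tilde\imath(R)\}$ (entry in position $j$). If $e_{j1},\dots,e_{j\varkappa_j}\in\mathcal{O}_{\mathbb{X},p_j}$ have residue classes forming a $K$-basis of $\kappa(p_j)$, put $\mu_{\mathbb{Y}/\mathbb{X}}=\max_k\mu(e_{jk}s_j)$ (independent of the choices). $\deg_{\mathbb{X}}(p_j)$ is the minimum of $\mu_{\mathbb{Y}/\mathbb{X}}$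 over all maximal $p_j$-subschemes $\mathbb{Y}$. $\mathbb{X}$ has the Cayley-Bacharach property of degree $d$, CBP($d$), if $\deg_{\mathbb{X}}(p_j)\ge d+1$ for all $j$. Dedekind different. $L_0=K[x_0,x_0^{-1}]$. A homogeneous trace map of degree zero of $Q^h(R)/L_0$ is a homogeneous element $\sigma$ of degree $0$ of the graded module $\underline{\mathrm{Hom}}_{L_0}(Q^h(R),L_0)$ which is a $Q^h(R)$-basis of it; it exists when $\mathbb{X}$ is locally Gorenstein. The Dedekind complementary module $\mathfrak{C}^\sigma_{\mathbb{X}}\subseteq Q^h(R)$ is the image of the injection $\underline{\mathrm{Hom}}_{K[x_0]}(R,K[x_0])\to\underline{\mathrm{Hom}}_{L_0}(Q^h(R),L_0)=Q^h(R)\sigma\cong Q^h(R)$, $\varphi\mapsto\varphi\otimes\mathrm{id}_{L_0}$ (the last isomorphism sending $g\sigma$ to $g$). The Dedekind different is $\delta^\sigma_{\mathbb{X}}=\{f\in Q^h(R)\mid f\cdot\mathfrak{C}^\sigma_{\mathbb{X}}\subseteq R\}$, a homogeneous ideal of $R$. *)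

(* Defs.v *)
From HB Require Import structures.
From mathcomp Require Import all_boot all_order all_algebra ring.
From mathcomp Require Import boolp.
From mathcomp Require Import mpoly.

Set Implicit Arguments.
Unset Strict Implicit.
Unset Printing Implicit Defensive.

Import GRing.Theory.
Local Open Scope ring_scope.
Local Open Scope quotient_scope.

(* MathComp has fractions over integral domains only; [loc S] is the          *)
(* localization of a commutative ring (with zero divisors, possibly zero) at  *)
(* a multiplicative set S: a/s = b/t iff u a t = u b s for some u in S.       *)
Section Localization.
Variables (A : comPzRingType) (S : GRing.MulClosed.type A).

Definition locpair := {x : A * A | x.2 \in S}.

Definition loc_rel (x y : locpair) : bool :=
  `[< exists2 u, u \in S &
      u * ((val x).1 * (val y).2) = u * ((val y).1 * (val x).2) >].

Lemma loc_rel_refl : reflexive loc_rel.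
Proof. by move=> x; apply/asboolP; exists 1; rewrite ?rpred1. Qed.

Lemma loc_rel_sym : ssrbool.symmetric loc_rel.
Proof.
by move=> x y; apply/asboolP/asboolP => -[u Su e]; exists u => //; rewrite e.
Qed.

Lemma loc_rel_trans : transitive loc_rel.
Proof.
move=> [[b t] /= St] [[a s] /= Ss] [[c w] /= Sw].
move=> /asboolP[u Su /= e1] /asboolP[v Sv /= e2].
apply/asboolP; exists (u * v * t); rewrite ?rpredM //=.
have -> : u * v * t * (a * w) = (u * (a * t)) * (v * w) by ring.
rewrite e1.
have -> : u * (b * s) * (v * w) = (v * (b * w)) * (u * s) by ring.
by rewrite e2; ring.
Qed.

Canonical loc_equiv := EquivRel loc_rel loc_rel_refl loc_rel_sym loc_rel_trans.

Definition loc := {eq_quot loc_rel}.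

HB.instance Definition _ : EqQuotient _ loc_rel loc := EqQuotient.on loc.
HB.instance Definition _ := Choice.on loc.

Definition mkpair (a s : A) (Ss : s \in S) : locpair := exist _ (a, s) Ss.

Lemma loc_denM (x y : locpair) : (val x).2 * (val y).2 \in S.
Proof. by rewrite rpredM //; [apply: (valP x) | apply: (valP y)]. Qed.

Definition pair_add (x y : locpair) : locpair :=
  mkpair ((val x).1 * (val y).2 + (val y).1 * (val x).2)
         (loc_denM x y).
Definition pair_opp (x : locpair) : locpair := mkpair (- (val x).1) (valP x).
Definition pair_mul (x y : locpair) : locpair :=
  mkpair ((val x).1 * (val y).1) (loc_denM x y).

Definition loc_add := lift_op2 loc pair_add.
Definition loc_opp := lift_op1 loc pair_opp.
Definition loc_mul := lift_op2 loc pair_mul.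
Definition tofrac (a : A) : loc := \pi_loc (mkpair a (rpred1 S)).

Lemma loc_eqP (x y : locpair) :
  reflect (exists2 u, u \in S &
             u * ((val x).1 * (val y).2) = u * ((val y).1 * (val x).2))
          (x == y %[mod loc]).
Proof. by rewrite eqmodE /=; apply: asboolP. Qed.

Lemma loc_reprP (x : locpair) : exists2 u, u \in S &
  u * ((val (repr (\pi_loc x))).1 * (val x).2)
    = u * ((val x).1 * (val (repr (\pi_loc x))).2).
Proof. by apply/loc_eqP; rewrite reprK. Qed.

Lemma pi_loc_add : {morph \pi : x y / pair_add x y >-> loc_add x y}.
Proof.
move=> x y; unlock loc_add; apply/eqP/loc_eqP => /=.
have [u Su e1] := loc_reprP x; have [v Sv e2] := loc_reprP y.
exists (u * v); rewrite ?rpredM // in e1 e2 *.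
set x' := val (repr _) in e1 *; set y' := val (repr _) in e2 *.
transitivity (v * (y'.2 * (val y).2) * (u * ((val x).1 * x'.2))
              + u * (x'.2 * (val x).2) * (v * ((val y).1 * y'.2))).
  by ring.
by rewrite -e1 -e2; ring.
Qed.

Lemma pi_loc_opp : {morph \pi : x / pair_opp x >-> loc_opp x}.
Proof.
move=> x; unlock loc_opp; apply/eqP/loc_eqP => /=.
have [u Su e1] := loc_reprP x; exists u => //.
by rewrite !mulNr !mulrN e1.
Qed.

Lemma pi_loc_mul : {morph \pi : x y / pair_mul x y >-> loc_mul x y}.
Proof.
move=> x y; unlock loc_mul; apply/eqP/loc_eqP => /=.
have [u Su e1] := loc_reprP x; have [v Sv e2] := loc_reprP y.
exists (u * v); rewrite ?rpredM // in e1 e2 *.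
set x' := val (repr _) in e1 *; set y' := val (repr _) in e2 *.
transitivity ((u * ((val x).1 * x'.2)) * (v * ((val y).1 * y'.2))).
  by ring.
by rewrite -e1 -e2; ring.
Qed.

Lemma loc_ind (Q : loc -> Prop) : (forall x, Q (\pi_loc x)) -> forall x, Q x.
Proof. by move=> H x; rewrite -[x]reprK. Qed.

Lemma loc_addA : associative loc_add.
Proof.
elim/loc_ind=> x; elim/loc_ind=> y; elim/loc_ind=> z.
rewrite -!pi_loc_add; apply/eqP/loc_eqP; exists 1; rewrite ?rpred1 //=; ring.
Qed.

Lemma loc_addC : commutative loc_add.
Proof.
elim/loc_ind=> x; elim/loc_ind=> y.
rewrite -!pi_loc_add; apply/eqP/loc_eqP; exists 1; rewrite ?rpred1 //=; ring.
Qed.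

Lemma loc_add0 : left_id (tofrac 0) loc_add.
Proof.
elim/loc_ind=> x.
rewrite -!pi_loc_add; apply/eqP/loc_eqP; exists 1; rewrite ?rpred1 //=; ring.
Qed.

Lemma loc_addN : left_inverse (tofrac 0) loc_opp loc_add.
Proof.
elim/loc_ind=> x; rewrite -pi_loc_opp -!pi_loc_add.
by apply/eqP/loc_eqP; exists 1; rewrite ?rpred1 //=; ring.
Qed.

HB.instance Definition _ :=
  GRing.isZmodule.Build loc loc_addA loc_addC loc_add0 loc_addN.

Lemma loc_mulA : associative loc_mul.
Proof.
elim/loc_ind=> x; elim/loc_ind=> y; elim/loc_ind=> z.
rewrite -!pi_loc_mul; apply/eqP/loc_eqP; exists 1; rewrite ?rpred1 //=; ring.
Qed.

Lemma loc_mulC : commutative loc_mul.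
Proof.
elim/loc_ind=> x; elim/loc_ind=> y.
rewrite -!pi_loc_mul; apply/eqP/loc_eqP; exists 1; rewrite ?rpred1 //=; ring.
Qed.

Lemma loc_mul1 : left_id (tofrac 1) loc_mul.
Proof.
elim/loc_ind=> x.
rewrite -!pi_loc_mul; apply/eqP/loc_eqP; exists 1; rewrite ?rpred1 //=; ring.
Qed.

Lemma loc_mulDl : left_distributive loc_mul loc_add.
Proof.
elim/loc_ind=> x; elim/loc_ind=> y; elim/loc_ind=> z.
rewrite -!pi_loc_add -!pi_loc_mul -!pi_loc_add.
by apply/eqP/loc_eqP; exists 1; rewrite ?rpred1 //=; ring.
Qed.

HB.instance Definition _ :=
  GRing.Zmodule_isComPzRing.Build loc loc_mulA loc_mulC loc_mul1 loc_mulDl.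

Lemma tofrac_is_zmod_morphism : zmod_morphism tofrac.
Proof.
move=> a b; rewrite -[RHS]/(loc_add (tofrac a) (loc_opp (tofrac b))).
rewrite -pi_loc_opp -pi_loc_add.
by apply/eqP/loc_eqP; exists 1; rewrite ?rpred1 //=; ring.
Qed.
HB.instance Definition _ :=
  GRing.isZmodMorphism.Build A loc tofrac tofrac_is_zmod_morphism.

Lemma tofrac_is_monoid_morphism : monoid_morphism tofrac.
Proof.
split=> [//|a b]; rewrite -[RHS]/(loc_mul (tofrac a) (tofrac b)) -pi_loc_mul.
by apply/eqP/loc_eqP; exists 1; rewrite ?rpred1 //=; ring.
Qed.
HB.instance Definition _ :=
  GRing.isMonoidMorphism.Build A loc tofrac tofrac_is_monoid_morphism.

(* For a graded ring A and a set S of homogeneous elements: the elements a/s  *)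
(* with a of degree m, s of degree e and m - e = i.                           *)
Definition loc_gr (gr : int -> A -> Prop) (i : int) (x : loc) : Prop :=
  exists m e a s, [/\ s \in S, gr e s, gr m a, m = i + e
                    & x * tofrac s = tofrac a].
End Localization.

(* Closed subschemes of P^n_K are given by their saturated homogeneous ideal, *)
(* and points of P^n_K by homogeneous primes not containing all X_i. The      *)
(* empty subscheme (the unit ideal) is allowed.                               *)
Section ProjectiveSpace.
Variables (K : fieldType) (n : nat).
Local Notation P := {mpoly K[n.+1]}.

Record subscheme := Subscheme {
  vanishing : {pred P};
  vanishing0 : 0 \in vanishing;
  vanishingD : {in vanishing &, forall f g, f + g \in vanishing};
  vanishingM : forall a, {in vanishing, forall f, a * f \in vanishing};
  vanishing_homog : {in vanishing, forall f i, pihomog mdeg i f \in vanishing};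
  vanishing_saturated : forall f,
    (exists N, forall m : 'X_{1..n.+1}, mdeg m = N ->
       'X_[m] * f \in vanishing) ->
    f \in vanishing }.

Record point := Point {
  pt :> {pred P};
  pt0 : 0 \in pt;
  ptD : {in pt &, forall f g, f + g \in pt};
  ptM : forall a, {in pt, forall f, a * f \in pt};
  pt1 : 1 \notin pt;
  pt_prime : forall f g, f * g \in pt -> (f \in pt) || (g \in pt);
  pt_homog : {in pt, forall f i, pihomog mdeg i f \in pt};
  pt_relevant : exists i : 'I_n.+1, 'X_i \notin pt }.

Lemma point_inj (p q : point) : pt p =i pt q -> p = q.
Proof.
case: p q => [p ? ? ? ? ? ? ?] [q ? ? ? ? ? ? ?] /= e.
have {}e : p = q by apply: funext => f; apply: e.
by subst q; congr Point; apply: Prop_irrelevance.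
Qed.

Definition supp (X : subscheme) (p : point) : Prop :=
  {subset vanishing X <= pt p}.

(* Y is a closed subscheme of X *)
Definition sub_scheme (Y X : subscheme) : Prop :=
  {subset vanishing X <= vanishing Y}.

(* The Krull dimension of the underlying space of X is 0: X is nonempty and   *)
(* has no proper specialization between two of its points.                    *)
Definition zero_dimensional (X : subscheme) : Prop :=
  (exists p, supp X p) /\
  (forall p q, supp X p -> supp X q -> {subset pt p <= pt q} -> p = q).

Section CoordinateRing.
Variable X : subscheme.

Lemma vanishing_zmod_closed : zmod_closed (vanishing X).
Proof.
split=> [|f g If Ig]; first exact: vanishing0.
by apply: vanishingD => //; rewrite -mulN1r; apply: vanishingM.
Qed.
HB.instance Definition _ :=
  GRing.isZmodClosed.Build P (vanishing X) vanishing_zmod_closed.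

(* R = P / I_X ; [{ideal_quot _}] would require a proper ideal *)
Definition hcoord := Quotient.quot (vanishing X).
HB.instance Definition _ := GRing.Zmodule.on hcoord.

Definition resid (f : P) : hcoord := \pi_hcoord f.
Definition hcoord_mul (x y : hcoord) : hcoord := resid (repr x * repr y).

Lemma resid_eqP f g : resid f = resid g <-> f - g \in vanishing X.
Proof. by rewrite Quotient.idealrBE; split => [/eqP|/eqP]. Qed.

Lemma resid_repr x : resid (repr x) = x.
Proof. exact: reprK. Qed.

Lemma residM f g : resid (f * g) = hcoord_mul (resid f) (resid g).
Proof.
apply/resid_eqP; set f' := repr (resid f); set g' := repr (resid g).
have If : f - f' \in vanishing X by apply/resid_eqP; rewrite resid_repr.
have Ig : g - g' \in vanishing X by apply/resid_eqP; rewrite resid_repr.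
have -> : f * g - f' * g' = g * (f - f') + f' * (g - g') by ring.
by apply: vanishingD; apply: vanishingM.
Qed.

Lemma residD f g : resid (f + g) = resid f + resid g.
Proof. exact: (raddfD \pi_(Quotient.quot (vanishing X))). Qed.

Lemma hcoord_mulA : associative hcoord_mul.
Proof.
move=> x y z; rewrite -[x]resid_repr -[y]resid_repr -[z]resid_repr.
by rewrite -!residM mulrA.
Qed.

Lemma hcoord_mulC : commutative hcoord_mul.
Proof.
by move=> x y; rewrite -[x]resid_repr -[y]resid_repr -!residM mulrC.
Qed.

Lemma hcoord_mul1 : left_id (resid 1) hcoord_mul.
Proof. by move=> x; rewrite -[x]resid_repr -!residM mul1r. Qed.

Lemma hcoord_mulDl : left_distributive hcoord_mul +%R.
Proof.
move=> x y z; rewrite -[x]resid_repr -[y]resid_repr -[z]resid_repr.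
by rewrite -residD -!residM -residD mulrDl.
Qed.

HB.instance Definition _ := GRing.Zmodule_isComPzRing.Build hcoord
  hcoord_mulA hcoord_mulC hcoord_mul1 hcoord_mulDl.

Lemma resid_is_zmod_morphism : zmod_morphism resid.
Proof. exact: (raddfB \pi_(Quotient.quot (vanishing X))). Qed.
HB.instance Definition _ :=
  GRing.isZmodMorphism.Build P hcoord resid resid_is_zmod_morphism.

Lemma resid_is_monoid_morphism : monoid_morphism resid.
Proof. by split=> // f g; rewrite residM. Qed.
HB.instance Definition _ :=
  GRing.isMonoidMorphism.Build P hcoord resid resid_is_monoid_morphism.

Definition x0 : hcoord := resid 'X_ord0.
Definition hscal (c : K) : hcoord := resid c%:MP.

(* R_i, with R_i = 0 for i < 0 *)
Definition hgr (i : int) (x : hcoord) : Prop :=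
  match i with
  | Posz k => exists2 f : P, f \is k.-homog & x = resid f
  | Negz _ => x = 0
  end.

Lemma hgr0 i : hgr i 0.
Proof. by case: i => //= k; exists 0; rewrite ?rpred0 ?rmorph0. Qed.

Lemma hgrM i j x y : hgr i x -> hgr j y -> hgr (i + j) (x * y).
Proof.
case: i j => [i|i] [j|j].
- move=> [f hf ->] [g hg ->]; rewrite -PoszD.
  by exists (f * g); rewrite ?rmorphM // dhomogM.
- by move=> _ hy; have -> : y = 0 := hy; rewrite mulr0; apply: hgr0.
- by move=> hx _; have -> : x = 0 := hx; rewrite mul0r; apply: hgr0.
by move=> hx _; have -> : x = 0 := hx; rewrite mul0r; apply: hgr0.
Qed.

Lemma hgrB i x y : hgr i x -> hgr i y -> hgr i (x - y).
Proof.
case: i => [i|i] /=; last by move=> -> ->; rewrite subr0.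
by move=> [f hf ->] [g hg ->]; exists (f - g); rewrite ?rmorphB ?rpredB.
Qed.

Lemma hgr_scal c : hgr 0 (hscal c).
Proof. by exists c%:MP; rewrite // -[c%:MP]mulr1 mul_mpolyC dhomogZ ?dhomog1. Qed.

Definition nonzerodivisor (A : comPzRingType) (x : A) : Prop :=
  forall y, x * y = 0 -> y = 0.

Definition hnzd : {pred hcoord} :=
  [pred x | `[< (exists i : nat, hgr i x) /\ nonzerodivisor x >]].

Lemma hnzd_mulr_closed : mulr_closed hnzd.
Proof.
split=> [|x y /asboolP[[i hx] nx] /asboolP[[j hy] ny]]; apply/asboolP; split.
- by exists 0%N; rewrite -(rmorph1 resid); exists 1; rewrite ?rpred1 ?dhomog1.
- by move=> y; rewrite mul1r.
- by exists (i + j)%N; rewrite PoszD; apply: hgrM.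
by move=> z; rewrite -mulrA => /nx/ny.
Qed.
HB.instance Definition _ := GRing.isMulClosed.Build hcoord hnzd hnzd_mulr_closed.

(* Q^h(R) and its grading *)
Local Notation Qh := (loc hnzd).
Local Notation toQh := (tofrac hnzd).
Definition qscal (c : K) : Qh := toQh (hscal c).
Definition Qgr : int -> Qh -> Prop := loc_gr hgr.

Section Stalk.
Variable p : point.

Definition off_pt : {pred hcoord} :=
  [pred x | `[< exists i (f : P), [/\ f \is i.-homog, f \notin pt p
                                    & x = resid f] >]].

Lemma off_pt_mulr_closed : mulr_closed off_pt.
Proof.
split=> [|_ _ /asboolP[i [f [hf nf ->]]] /asboolP[j [g [hg ng ->]]]];
  apply/asboolP.
  by exists 0%N, 1; rewrite dhomog1 pt1 rmorph1.
exists (i + j)%N, (f * g); rewrite rmorphM dhomogM //; split=> //.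
by apply/negP => /pt_prime; rewrite (negPf nf) (negPf ng).
Qed.
HB.instance Definition _ :=
  GRing.isMulClosed.Build hcoord off_pt off_pt_mulr_closed.

(* O_{X,p} is the degree 0 part of the localization of R at the homogeneous   *)
(* elements outside p; it is the zero ring if p is not a point of X.          *)
Local Notation toloc := (tofrac off_pt).

Definition stalk_pred : {pred loc off_pt} :=
  [pred x | `[< loc_gr hgr 0 x >]].

Lemma stalk_subring_closed : subring_closed stalk_pred.
Proof.
split=> [|x y|x y].
- apply/asboolP; exists 0, 0, 1, 1; split; rewrite ?rpred1 ?addr0 ?mul1r //.
    by exists 1; rewrite ?dhomog1 ?rmorph1.
  by exists 1; rewrite ?dhomog1 ?rmorph1.
- move=> /asboolP[m [e [a [s [Ss hs ha]]]]]; rewrite add0r => em ex; subst m.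
  move=> /asboolP[m' [e' [b [t [St ht hb]]]]]; rewrite add0r => em ey; subst m'.
  apply/asboolP; exists (e + e'), (e + e'), (a * t - b * s), (s * t).
  split; rewrite ?rpredM ?add0r //; try exact: hgrM.
  - by apply: hgrB; [exact: hgrM | rewrite addrC; exact: hgrM].
  by rewrite rmorphB !rmorphM /= -ex -ey; ring.
move=> /asboolP[m [e [a [s [Ss hs ha]]]]]; rewrite add0r => em ex; subst m.
move=> /asboolP[m' [e' [b [t [St ht hb]]]]]; rewrite add0r => em ey; subst m'.
apply/asboolP; exists (e + e'), (e + e'), (a * b), (s * t).
split; rewrite ?rpredM ?add0r //; try exact: hgrM.
by rewrite !rmorphM /= -ex -ey; ring.
Qed.
HB.instance Definition _ :=
  GRing.isSubringClosed.Build (loc off_pt) stalk_pred stalk_subring_closed.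

Definition stalk := {x : loc off_pt | x \in stalk_pred}.
HB.instance Definition _ := SubChoice.on stalk.
HB.instance Definition _ := [SubChoice_isSubZmodule of stalk by <:].
HB.instance Definition _ := GRing.SubZmodule_isSubPzRing.Build
  (loc off_pt) stalk_pred stalk stalk_subring_closed.
HB.instance Definition _ := GRing.SubPzRing_isSubComPzRing.Build
  (loc off_pt) stalk_pred stalk.

Lemma stalk_scal_subproof c : tofrac off_pt (hscal c) \in stalk_pred.
Proof.
apply/asboolP; exists 0, 0, (hscal c), 1; rewrite rpred1 rmorph1 mulr1.
split=> //; last exact: hgr_scal.
by exists 1; rewrite ?dhomog1 ?rmorph1.
Qed.
Definition stalk_scal (c : K) : stalk :=
  exist _ (tofrac off_pt (hscal c)) (stalk_scal_subproof c).
End Stalk.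
End CoordinateRing.

Local Notation toloc X p := (tofrac (off_pt (X := X) p)).

(* U has dimension m over K, where U is a K-subspace of a ring A on which K   *)
(* acts through sc : K -> A                                                   *)
Definition has_dim (A : comPzRingType) (sc : K -> A) (U : A -> Prop)
    (m : nat) : Prop :=
  exists e : 'I_m -> A, (forall k, U (e k)) /\
    forall a, U a ->
      exists! c : {ffun 'I_m -> K}, a = \sum_(k < m) sc (c k) * e k.

Definition has_degree (X : subscheme) (D : nat) : Prop :=
  exists s (p : 'I_s -> point) (m : 'I_s -> nat),
    [/\ injective p,
        forall q, supp X q <-> exists j, q = p j,
        forall j, has_dim (@stalk_scal X (p j)) (fun _ => True) (m j)
      & D = (\sum_(j < s) m j)%N].

Definition is_regularity_index (X : subscheme) (r : nat) : Prop :=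
  exists D, has_degree X D /\
    let HF_eventually_D (k : nat) :=
      forall i : nat, (k <= i)%N -> has_dim (hscal X) (hgr (X := X) i) D in
    HF_eventually_D r /\ forall k, HF_eventually_D k -> (r <= k)%N.

Section LocalRing.
Variables (X : subscheme) (p : point).
Local Notation O := (stalk X p).

(* the maximal ideal, i.e. the non-units, of the local ring O_{X,p} *)
Definition stalk_max (a : O) : Prop := ~ exists b, a * b = 1.

(* the residue classes of the e k form a K-basis of kappa(p) *)
Definition residue_basis m (e : 'I_m -> O) : Prop :=
  forall a, exists! c : {ffun 'I_m -> K},
    stalk_max (a - \sum_(k < m) stalk_scal X p (c k) * e k).

Definition residue_degree (m : nat) : Prop :=
  exists e : 'I_m -> O, residue_basis e.

Definition socle (a : O) : Prop := forall b, stalk_max b -> b * a = 0.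

(* a is the germ f_p of f, homogeneous of degree i, i.e. a = f / x_0^i, which *)
(* determines a because x_0 is invertible at a point off X_0 = 0              *)
Definition is_germ (i : nat) (f : P) (a : O) : Prop :=
  val a * toloc X p (x0 X) ^+ i = toloc X p (resid X f).

End LocalRing.

(* the graph of the canonical map O_{X,p} -> O_{Y,p} for Y in X; both sides   *)
(* are ring elements represented by the same fraction f / g                   *)
Definition stalk_map (X Y : subscheme) (p : point)
    (a : stalk X p) (b : stalk Y p) : Prop :=
  exists i (f g : P), [/\ f \is i.-homog, g \is i.-homog, g \notin pt p,
    val a * toloc X p (resid X g) = toloc X p (resid X f)
  & val b * toloc Y p (resid Y g) = toloc Y p (resid Y f)].

Definition stalk_map_inj X Y p : Prop :=
  forall a, @stalk_map X Y p a 0 -> a = 0.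
Definition stalk_map_surj X Y p : Prop :=
  forall b, exists a, @stalk_map X Y p a b.

Definition is_p_subscheme (X : subscheme) (p : point) (Y : subscheme) : Prop :=
  [/\ sub_scheme Y X,
      forall q, supp X q -> q <> p -> stalk_map_inj X Y q /\ stalk_map_surj X Y q
    & stalk_map_surj X Y p].

Definition is_maximal_p_subscheme X p Y : Prop :=
  is_p_subscheme X p Y /\
  exists D D' k, [/\ has_degree X D, has_degree Y D', residue_degree X p k
                   & D = (D' + k)%N].

Definition least (Q : nat -> Prop) : nat :=
  if pselect (exists m, `[< Q m >]) is left h then ex_minn h else 0%N.

Section CayleyBacharach.
Variable X : subscheme.

(* (0,..,0,a T_p^i,0,..,0) lies in the image of                               *)
(*   itilde : R -> \prod_q O_{X,q}[T_q, 1/T_q];                               *)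
(* the coefficient of T_q^m in the q-th entry of itilde(g) is the germ at q   *)
(* of the homogeneous component of degree m of g.                             *)
Definition in_itilde_image (p : point) (i : nat) (a : stalk X p) : Prop :=
  exists g : P, is_germ i (pihomog mdeg i g) a /\
    forall q (m : nat), supp X q -> (q <> p \/ m <> i) ->
      is_germ (X := X) (p := q) m (pihomog mdeg m g) 0.

Definition mu (p : point) (a : stalk X p) : nat :=
  least (fun i => in_itilde_image i a).

(* v = mu_{Y/X} for the maximal p-subscheme Y with O_{Y,p} = O_{X,p} / <s> *)
Definition is_muYX (p : point) (Y : subscheme) (v : nat) : Prop :=
  exists m (e : 'I_m -> stalk X p) (s : stalk X p),
    [/\ residue_basis e, s <> 0 /\ socle s,
        forall a, stalk_map (Y := Y) a 0 <-> exists b, a = b * s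
      & v = (\max_(k < m) mu (e k * s)%R)%N].

Definition deg_pt (p : point) : nat :=
  least (fun v => exists2 Y, is_maximal_p_subscheme X p Y & is_muYX p Y v).

Definition CBP (d : nat) : Prop :=
  forall p, supp X p -> (d.+1 <= deg_pt p)%N.
End CayleyBacharach.
End ProjectiveSpace.

Notation Qh X := (loc (hnzd (X := X))).
Notation toQh X := (tofrac (hnzd (X := X))).

Definition lin_over (A : comPzRingType) (B : A -> Prop) (phi : A -> A) : Prop :=
  [/\ forall x, B (phi x), {morph phi : x y / x + y}
    & forall l x, B l -> phi (l * x) = l * phi x].

Definition of_degree (A : comPzRingType) (gr : int -> A -> Prop) (i : int)
    (phi : A -> A) : Prop :=
  forall j x, gr j x -> gr (i + j) (phi x).

(* phi is in the graded module \underline{Hom}_B(A, B), for B a subring of A: *)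
(* it is a finite sum of homogeneous B-linear maps with values in B           *)
Definition graded_hom (A : comPzRingType) (gr : int -> A -> Prop)
    (B : A -> Prop) (phi : A -> A) : Prop :=
  exists m (psi : 'I_m -> A -> A) (i : 'I_m -> int),
    (forall k, lin_over B (psi k) /\ of_degree gr (i k) (psi k)) /\
    forall x, phi x = \sum_(k < m) psi k x.

Section DedekindDifferent.
Variables (K : fieldType) (n : nat) (X : subscheme K n).
Local Notation R := (hcoord X).
Local Notation x0 := (x0 X).

(* K[x_0] in R and L_0 = K[x_0, 1/x_0] in Q^h(R) *)
Definition in_Kx0 (r : R) : Prop :=
  exists m (c : nat -> K), r = \sum_(i < m) hscal X (c i) * x0 ^+ i.
Definition in_L0 (l : Qh X) : Prop :=
  exists e r, in_Kx0 r /\ l * toQh X x0 ^+ e = toQh X r.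

Definition is_trace_map (sigma : Qh X -> Qh X) : Prop :=
  [/\ lin_over in_L0 sigma, of_degree (Qgr (X := X)) 0 sigma
    & forall phi, graded_hom (Qgr (X := X)) in_L0 phi ->
        exists! g : Qh X, forall x, phi x = sigma (g * x)].

(* g sigma = phi (x) id_{L_0} for some phi, where Q^h(R) = R (x) L_0 *)
Definition complementary_module (sigma : Qh X -> Qh X) (g : Qh X) : Prop :=
  exists phi, graded_hom (hgr (X := X)) in_Kx0 phi /\
    forall r l, in_L0 l -> sigma (g * (toQh X r * l)) = toQh X (phi r) * l.

Definition different (sigma : Qh X -> Qh X) (f : Qh X) : Prop :=
  forall g, complementary_module sigma g -> exists r, f * g = toQh X r.

Definition has_HF_different (sigma : Qh X -> Qh X) (i : int) (m : nat) : Prop :=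
  has_dim (qscal X) (fun f => different sigma f /\ Qgr i f) m.
End DedekindDifferent.

Definition injective_module (A : comPzRingType) (E : lmodType A) : Prop :=
  forall (M N : lmodType A) (f : {linear M -> N}) (g : {linear M -> E}),
    injective f -> exists h : {linear N -> E}, forall x, h (f x) = g x.

Fixpoint injdim_le (A : comPzRingType) (k : nat) (M : lmodType A) : Prop :=
  match k with
  | 0 => injective_module M
  | k'.+1 => exists (E C : lmodType A) (f : {linear M -> E}) (g : {linear E -> C}),
      [/\ injective_module E, injective f, forall c, exists e, g e = c,
          forall e, g e = 0 <-> exists x, e = f x & injdim_le k' C]
  end.

Definition is_ideal (A : comPzRingType) (J : A -> Prop) : Prop :=
  [/\ J 0, forall a b, J a -> J b -> J (a + b) & forall a b, J b -> J (a * b)].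

Definition noetherian (A : comPzRingType) : Prop :=
  forall J : A -> Prop, is_ideal J ->
    exists m (g : 'I_m -> A), forall a,
      J a <-> exists c : 'I_m -> A, a = \sum_(k < m) c k * g k.

(* Gorenstein local ring: noetherian and of finite injective dimension; [A] is *)
(* meant to be local, and a non-local ring would need its localizations.      *)
Definition gorenstein (A : comPzRingType) : Prop :=
  noetherian A /\ exists k, @injdim_le A k A^o.

Definition locally_gorenstein (K : fieldType) (n : nat) (X : subscheme K n) : Prop :=
  forall p, supp X p -> gorenstein (stalk X p).

(* Main.v *)
(* Let f be a nonzero element of degree d of the different. A trace map of
   degree 0 sends elements of degree i >= 0 to multiples of x_0^i, so the
   complementary module contains every element of Q^h(R) of degree 0; hence f
   lies in R_d, and so does f b for every b of degree 0. At a point p where the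
   germ a of f is nonzero, taking b = (0,..,c,..,0) shows that mu(c a) <= d for
   every c in O_{X,p}. As O_{X,p} is Gorenstein and artinian, its socle is
   generated by any nonzero element of it, and some multiple of a is one; so
   every socle element s has the form c a. Thus mu(e s) <= d for all e in
   O_{X,p}, whence mu_{Y/X} <= d for every maximal p-subscheme Y, against CBP(d).
   Since HF_X is eventually deg(X), the germ map R_i -> \prod_p O_{X,p},
   surjective for large i, is then also injective; by saturation germs detect
   vanishing in every degree, and x_0 is a nonzerodivisor. *)
Require Import Defs.
From HB Require Import structures.
From mathcomp Require Import all_boot all_order all_algebra.
From mathcomp Require Import ring.
From mathcomp Require Import boolp.
From mathcomp Require Import mpoly.
Set Implicit Arguments.
Unset Strict Implicit.
Unset Printing Implicit Defensive.
Import GRing.Theory.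
Local Open Scope ring_scope.
Local Open Scope quotient_scope.
(* all_algebra also exports a [tofrac], for integral domains. *)
Local Notation tofrac := Defs.tofrac.

Definition nonunit (A : comPzRingType) (a : A) : Prop := ~ exists b, a * b = 1.

(** * Gorenstein artinian local rings *)

Section Submodule.
Variables (A : comPzRingType) (J : A -> Prop) (idJ : is_ideal J).

Definition ideal_pred : {pred A^o} := [pred x | `[< J x >]].

Lemma ideal_submod_closed : submod_closed ideal_pred.
Proof.
case: idJ => J0 JD JM; split=> [|a u v]; first exact/asboolP.
by move=> /asboolP Ju /asboolP Jv; apply/asboolP/JD => //; apply: JM.
Qed.
HB.instance Definition _ :=
  GRing.isSubmodClosed.Build A A^o ideal_pred ideal_submod_closed.

Definition ideal_mod := {x : A^o | x \in ideal_pred}.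
HB.instance Definition _ := SubChoice.on ideal_mod.
HB.instance Definition _ := [SubChoice_isSubLmodule of ideal_mod by <:].

(** The map [h], linear on J only, extends along the inclusion of J in A, and a linear map on A is
    determined by the image of 1. *)
Lemma injective_module_ideal_hom (E : lmodType A) (h : A -> E) :
    injective_module E ->
    (forall a x y, J x -> J y -> h (a * x + y) = a *: h x + h y) ->
  exists e, forall x, J x -> h x = x *: e.
Proof.
move=> injE hlin.
pose g (x : ideal_mod) : E := h (val x).
have glin : linear g.
  move=> a x y; rewrite /g linearP; apply: hlin.
    exact/asboolP/(valP x).
  exact/asboolP/(valP y).
pose gM := GRing.isLinear.Build A ideal_mod E *:%R g glin.
pose gL : {linear ideal_mod -> E} := HB.pack g gM.
have [k kE] := injE ideal_mod A^o val gL val_inj.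
exists (k 1) => x Jx.
have Jx' : x \in ideal_pred by apply/asboolP.
rewrite -linearZ /= -[RHS](_ : k (val (Sub x Jx' : ideal_mod)) = _).
  by rewrite kE.
by rewrite SubK; congr (k _); rewrite /GRing.scale /= mulr1.
Qed.
End Submodule.

(* For a nonzero ring A this says that A is local. *)
Definition nonunits_add (A : comPzRingType) : Prop :=
  forall a b : A, nonunit a -> nonunit b -> nonunit (a + b).

(** * Ideals and noetherian induction *)

Section Ideals.
Variable A : comPzRingType.
Implicit Types (J : A -> Prop) (a b x t : A).

Lemma nonunitMl a b : nonunit b -> nonunit (a * b).
Proof.
by move=> nb [c abc]; apply: nb; exists (c * a); rewrite -abc; ring.
Qed.

Lemma nonunitN a : nonunit a -> nonunit (- a).
Proof. by rewrite -mulN1r; apply: nonunitMl. Qed.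

Lemma idealB J a b : is_ideal J -> J a -> J b -> J (a - b).
Proof.
by case=> _ JD JM Ja Jb; apply: JD => //; rewrite -mulN1r; apply: JM.
Qed.

Lemma ideal_add_span J t :
  is_ideal J -> is_ideal (fun y => exists a, J (y - a * t)).
Proof.
case=> J0 JD JM; split.
- by exists 0; rewrite mul0r subr0.
- move=> x y [a Ja] [b Jb]; exists (a + b).
  by rewrite (_ : _ - _ = (x - a * t) + (y - b * t)); [apply: JD | ring].
move=> c x [a Ja]; exists (c * a).
by rewrite (_ : _ - _ = c * (x - a * t)); [apply: JM | ring].
Qed.

Lemma generator_mem J m (g : 'I_m -> A) :
    (forall a, J a <-> exists c : 'I_m -> A, a = \sum_(k < m) c k * g k) ->
  forall i, J (g i).
Proof.
move=> gP i; apply/gP; exists (fun j => (j == i)%:R).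
rewrite (bigD1 i) //= eqxx mul1r big1 ?addr0 // => j /negPf ->.
by rewrite mul0r.
Qed.

Lemma zero_ideal : is_ideal (fun x : A => x = 0).
Proof.
by split=> // [_ _ -> ->|a _ ->]; rewrite ?addr0 ?mulr0.
Qed.

Lemma ideal_sum J m (g c : 'I_m -> A) :
  is_ideal J -> (forall k, J (g k)) -> J (\sum_(k < m) c k * g k).
Proof.
by case=> J0 JD JM Jg; apply: big_ind => // k _; apply: JM.
Qed.

(** Otherwise dependent choice gives a strictly ascending chain of ideals violating Q; its union is
    finitely generated, so some member of the chain already contains it. *)
Lemma noetherian_ind (Q : (A -> Prop) -> Prop) :
    noetherian A ->
    (forall J, is_ideal J ->
       (forall J', is_ideal J' -> (forall x, J x -> J' x) ->
          (exists2 t, J' t & ~ J t) -> Q J') ->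
     Q J) ->
  forall J, is_ideal J -> Q J.
Proof.
move=> noeth IH J idJ; apply: contrapT => nQJ.
pose T := {J | is_ideal J /\ ~ Q J}.
have next (I : T) : {I' : T | (forall x, sval I x -> sval I' x) /\
    exists2 t, sval I' t & ~ sval I t}.
  apply: cid; case: I => I [idI nQI] /=; apply: contrapT => nI.
  apply: nQI; apply: (IH I idI) => I' idI' sII' ltII'.
  by apply: contrapT => nQI'; apply: nI; exists (exist _ I' (conj idI' nQI')).
pose F k : T := iter k (fun I => sval (next I)) (exist _ J (conj idJ nQJ)).
have FS k x : sval (F k) x -> sval (F k.+1) x.
  by rewrite /F /=; case: (next _) => I' /= [h _] /h.
have Fmono k l x : (k <= l)%N -> sval (F k) x -> sval (F l) x.
  move=> kl Fx; rewrite -(subnKC kl); elim: (l - k)%N => [|i Fi].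
    by rewrite addn0.
  by rewrite addnS; apply: FS.
have idF k : is_ideal (sval (F k)) by case: (F k) => I [].
have idU : is_ideal (fun x => exists k, sval (F k) x).
  split; first by exists 0%N; case: (idF 0%N).
  - move=> a b [k Fa] [l Fb]; exists (maxn k l).
    case: (idF (maxn k l)) => _ D _; apply: D.
      by apply: Fmono Fa; apply: leq_maxl.
    by apply: Fmono Fb; apply: leq_maxr.
  by move=> a b [k Fb]; exists k; case: (idF k) => _ _; apply.
have [m [g gP]] := noeth _ idU.
have [kk kkP] := choice (generator_mem gP).
pose N := (\max_i kk i)%N.
have gN i : sval (F N) (g i) by apply: Fmono (kkP i); apply: leq_bigmax.
have [t Ft nFt] : exists2 t, sval (F N.+1) t & ~ sval (F N) t.
  by rewrite /F /=; case: (next _) => I' /= [].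
apply: nFt; have [|c ->] := (gP t).1; first by exists N.+1.
exact: ideal_sum.
Qed.

End Ideals.

Section ArtinianLocal.
Variable A : comPzRingType.
Hypotheses (locA : nonunits_add A) (noethA : noetherian A).
Hypothesis nilA : forall a : A, nonunit a -> exists n, a ^+ n = 0.
Implicit Types (J : A -> Prop) (a b s x t : A).

(* Multiply x successively by the highest powers of generators of the maximal
   ideal that keep it outside J. *)
Lemma relative_socle_exists J x : is_ideal J -> ~ J x ->
  exists b, ~ J (b * x) /\ forall a, nonunit a -> J (a * (b * x)).
Proof.
move=> idJ nJx; have [J0 JD JM] := idJ.
(* Since x is outside J, A is nonzero, so 0 is a nonunit and the nonunits form an ideal. *)
have n1 : (1 : A) <> 0 by move=> e; apply: nJx; rewrite -[x]mul1r e mul0r.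
have n0 : nonunit (0 : A) by case=> b; rewrite mul0r => /esym/n1.
have idm : is_ideal (@nonunit A) by split=> //; apply: nonunitMl.
have [m [g gP]] := noethA idm.
have ng := generator_mem gP.
have [b [nJb Jb]] : exists b, ~ J (b * x) /\
    forall i : 'I_m, J (g i * (b * x)).
  suff H k : (k <= m)%N -> exists b, ~ J (b * x) /\
      forall i : 'I_m, (i < k)%N -> J (g i * (b * x)).
    by have [b [nJb Jb]] := H m (leqnn m); exists b; split=> // i; apply: Jb.
  elim: k => [|k IHk] km; first by exists 1; rewrite mul1r.
  have [b [nJb Jb]] := IHk (ltnW km).
  pose gk := g (Ordinal km).
  have ex : exists i, `[< J (gk ^+ i * (b * x)) >].
    have [i gi0] := nilA (ng (Ordinal km)); exists i; apply/asboolP.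
    by rewrite /gk gi0 mul0r.
  case: (ex_minnP ex) => [[|i]] /asboolP Ji imin.
    by case: nJb; rewrite expr0 mul1r in Ji.
  exists (gk ^+ i * b); split=> [|j].
    rewrite -mulrA => Ji'; have := imin i; rewrite ltnn.
    by move=> /(_ _)/negP; apply; first exact/asboolP.
  rewrite ltnS leq_eqVlt => /orP[/eqP jk|/Jb Jj].
    have -> : g j = gk by congr (g _); apply: val_inj.
    by move: Ji; rewrite exprS !mulrA.
  by rewrite (_ : _ * _ = gk ^+ i * (g j * (b * x))); [apply: JM | ring].
exists b; split=> // a /(gP a)[c ->]; rewrite mulr_suml.
apply: big_ind => // k _.
by rewrite -mulrA; apply: JM.
Qed.

(** On J + At the map j + a t -> a e is well defined: if (a - b) t lies in J, then a - b is a
    nonunit, as t is not in J, and so it kills e. Injectivity extends the map to A, and e' is the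
    image of 1. *)
Lemma injective_module_extend (E : lmodType A) J t (e : E) :
    injective_module E -> is_ideal J -> ~ J t ->
    (forall a, nonunit a -> a *: e = 0) ->
  exists e', (forall x, J x -> x *: e' = 0) /\ t *: e' = e.
Proof.
move=> injE idJ nJt me; have [J0 JD JM] := idJ.
pose J' y := exists a, J (y - a * t).
have idJ' : is_ideal J' := ideal_add_span t idJ.
pose co y : A := if pselect (J' y) is left h then sval (cid h) else 0.
have coE y a : J (y - a * t) -> co y *: e = a *: e.
  move=> Jy; rewrite /co; case: pselect => [h|[]]; last by exists a.
  case: cid => b /= Jb; apply/eqP; rewrite -subr_eq0 -scalerBl; apply/eqP.
  apply: me => -[c bac]; apply: nJt.
  rewrite (_ : t = c * ((y - a * t) - (y - b * t))).
    by apply: JM; apply: (idealB idJ).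
  by transitivity ((b - a) * c * t); [rewrite bac mul1r | ring].
have hlin a x y : J' x -> J' y ->
    co (a * x + y) *: e = a *: (co x *: e) + co y *: e.
  move=> [b Jb] [c Jc].
  rewrite (coE x b Jb) (coE y c Jc) (coE _ (a * b + c)).
    by rewrite scalerDl scalerA.
  rewrite (_ : _ - _ = a * (x - b * t) + (y - c * t)); last by ring.
  by apply: JD => //; apply: JM.
have [e' e'P] :=
  injective_module_ideal_hom idJ' (h := fun y => co y *: e) injE hlin.
exists e'; split=> [x Jx|].
  rewrite -e'P ?(coE x 0) ?scale0r ?mul0r ?subr0 //.
  by exists 0; rewrite mul0r subr0.
rewrite -e'P ?(coE t 1) ?scale1r ?mul1r ?subrr //.
by exists 1; rewrite mul1r subrr.
Qed.

(* Ext^1(A/m, M) = 0 for 0 -> M -> E -> C -> 0 gives Ext^1(A/J, M) = 0, by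
   descending induction on J. *)
Lemma lift_annihilated (E C : lmodType A) (g : {linear E -> C}) :
    injective_module E ->
    (forall c, (forall a, nonunit a -> a *: c = 0) ->
       exists2 e, g e = c & forall a, nonunit a -> a *: e = 0) ->
  forall J, is_ideal J -> forall c, (forall x, J x -> x *: c = 0) ->
    exists2 e, g e = c & forall x, J x -> x *: e = 0.
Proof.
move=> injE lift; apply: noetherian_ind => // J idJ IH c Jc.
have [J1|nJ1] := pselect (J 1).
  exists 0; last by move=> x _; rewrite scaler0.
  by rewrite linear0 -[c]scale1r Jc.
have [t [nJt mt]] := relative_socle_exists idJ nJ1.
rewrite mulr1 in nJt mt.
(* Modulo J, t is a socle element, so t c is killed by the nonunits and lifts to e1 = t e2 with e2
   killed by J; then c - g e2 is killed by the larger ideal J + At. *)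
have [|e1 ge1 me1] := lift (t *: c).
  by move=> a na; rewrite scalerA Jc //; apply: mt.
have [e2 [Je2 te2]] := injective_module_extend injE idJ nJt me1.
have [J0 JD JM] := idJ.
have [|||e3 ge3 J'e3] := IH _ (ideal_add_span t idJ) _ _ (c - g e2).
- by move=> x Jx; exists 0; rewrite mul0r subr0.
- by exists t => //; exists 1; rewrite mul1r subrr.
- move=> x [a Ja]; rewrite -[x](subrK (a * t)) scalerDl scalerBr Jc //.
  rewrite -linearZ /= Je2 // linear0 subr0 add0r -scalerA.
  by rewrite scalerBr -linearZ /= te2 ge1 subrr scaler0.
exists (e2 + e3); first by rewrite linearD ge3 addrC subrK.
move=> x Jx; rewrite scalerDr Je2 // J'e3 ?addr0 //.
by exists 0; rewrite mul0r subr0.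
Qed.

(* A module M of finite injective dimension over an artinian local ring is
   injective; extending the map s |-> c from sA to A then shows that c lies in
   sM. *)
Lemma injdim_socle_sub s k (M : lmodType A) :
    s <> 0 -> (forall a, nonunit a -> a * s = 0) -> injdim_le k M ->
  forall c : M, (forall a, nonunit a -> a *: c = 0) -> exists c', c = s *: c'.
Proof.
move=> s0 ms; elim: k M => [|k IHk] M /=.
  move=> injM c mc.
  have [c' [_ <-]] := injective_module_extend injM (@zero_ideal A) s0 mc.
  by exists c'.
move=> [E [C [f [g [injE finj gsurj exact dimC]]]]] c mc.
(* Socle elements of C have the form s c1 by induction; the lift s e1 is killed by the nonunits
   because s is. *)
have lift c0 : (forall a, nonunit a -> a *: c0 = 0) ->
    exists2 e, g e = c0 & forall a, nonunit a -> a *: e = 0.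
  move=> mc0; have [c1 ->] := IHk C dimC c0 mc0.
  have [e1 <-] := gsurj c1; exists (s *: e1); first by rewrite linearZ.
  by move=> a na; rewrite scalerA ms // scale0r.
(* Here s e = f c, so s kills g e. Subtracting from e a lift e' of g e that s kills moves it into
   the image of f without changing s e. *)
have [|e [_ se]] := injective_module_extend (e := f c) injE (@zero_ideal A) s0.
  by move=> a na; rewrite -linearZ /= mc // linear0.
have ids : is_ideal (fun x : A => exists a, x - a * s = 0).
  exact: (ideal_add_span s (@zero_ideal A)).
have [|e' ge' se'] := lift_annihilated injE lift ids (c := g e).
  move=> x [a /eqP]; rewrite subr_eq0 => /eqP ->; rewrite -scalerA.
  rewrite (_ : s *: g e = 0) ?scaler0 //; rewrite -linearZ /= se.
  by apply/(exact (f c)); exists c.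
have [|m fm] := (exact (e - e')).1; first by rewrite linearB ge' subrr.
exists m; apply: finj; rewrite linearZ /= -fm scalerBr se se' ?subr0 //.
by exists 1; rewrite mul1r subrr.
Qed.

End ArtinianLocal.

Lemma gorenstein_socle_sub (A : comPzRingType) (s t : A) :
    nonunits_add A -> (forall a : A, nonunit a -> exists n, a ^+ n = 0) ->
    gorenstein A -> s <> 0 -> (forall a, nonunit a -> a * s = 0) ->
    (forall a, nonunit a -> a * t = 0) ->
  exists b, t = b * s.
Proof.
move=> locA nilA [noethA [k dimA]] s0 ms mt.
have [|b ->] := injdim_socle_sub locA noethA nilA s0 ms dimA (c := t) _.
  exact: mt.
by exists b; rewrite /GRing.scale /= mulrC.
Qed.

(** * Finite-dimensional algebras *)

Section FiniteDimension.
Variables (K : fieldType) (A : comPzRingType) (sc : {rmorphism K -> A}).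

(** Low-order zero coefficients are absorbed into the power of x, and the relation is divided by the
    first nonzero one. *)
Lemma root_nonzero_factor (x : A) N (w : nat -> K) j :
    x ^+ j * (\sum_(i < N) sc (w i) * x ^+ i) = 0 ->
    (exists2 i, (i < N)%N & w i != 0) ->
  exists i M (c : nat -> K),
    x ^+ i * (1 + x * \sum_(k < M) sc (c k) * x ^+ k) = 0.
Proof.
elim: N w j => [|N IHN] w j; first by move=> _ [].
rewrite big_ord_recl /= expr0 mulr1.
have -> : \sum_(i < N) sc (w (bump 0 i)) * x ^+ bump 0 i =
    x * \sum_(i < N) sc (w i.+1) * x ^+ i.
  by rewrite mulr_sumr; apply: eq_bigr => i _; rewrite exprS mulrCA.
have [w0|w0] := eqVneq (w 0%N) 0.
  rewrite w0 rmorph0 add0r mulrA -exprSr => xw [[|i] iN wi0].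
    by rewrite w0 eqxx in wi0.
  by apply: (IHN (fun k => w k.+1) _ xw); exists i.
move=> xw _; exists j, N, (fun k => (w 0%N)^-1 * w k.+1).
transitivity (sc (w 0%N)^-1 * (x ^+ j * (sc (w 0%N) +
    x * \sum_(i < N) sc (w i.+1) * x ^+ i))); last by rewrite xw mulr0.
rewrite mulrCA; congr (_ * _); rewrite mulrDr -rmorphM mulVf // rmorph1.
congr (_ + _); rewrite mulrCA; congr (_ * _); rewrite mulr_sumr.
apply: eq_bigr => k _.
by rewrite rmorphM mulrA.
Qed.

(** The m + 1 powers 1, x, ..., x^m are linearly dependent. *)
Lemma finite_dim_root m : has_dim sc (fun _ => True) m -> forall x,
  exists i N (c : nat -> K),
    x ^+ i * (1 + x * \sum_(k < N) sc (c k) * x ^+ k) = 0.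
Proof.
move=> [e [_ eP]] x.
have coord (i : nat) : exists c : {ffun 'I_m -> K},
    x ^+ i = \sum_(k < m) sc (c k) * e k.
  by have [c [cE _]] := eP (x ^+ i) I; exists c.
have [c cP] := choice coord.
pose M := \matrix_(i < m.+1, k < m) c i k.
(* The coordinate matrix has more rows than columns, so its left kernel is nonzero; the entries of
   [v] are the coefficients of the relation. *)
pose v := nz_row (kermx M).
have v0 : v != 0.
  rewrite nz_row_eq0 kermx_eq0 /row_free eqn_leq negb_and -!ltnNge ltnS.
  by rewrite rank_leq_col orbT.
have vM : v *m M = 0 by apply/sub_kermxP/nz_row_sub.
have [i0 vi0] : exists i, v 0 i != 0 by apply/rV0Pn.
apply: (@root_nonzero_factor x m.+1 (fun i => v 0 (inord i)) 0); last first.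
  by exists i0; rewrite ?inord_val.
rewrite expr0 mul1r.
under eq_bigr => i _ do rewrite inord_val cP mulr_sumr.
rewrite exchange_big big1 //= => k _.
transitivity (sc ((v *m M) 0 k) * e k); last by rewrite vM mxE rmorph0 mul0r.
rewrite mxE rmorph_sum mulr_suml; apply: eq_bigr => i _.
by rewrite mxE rmorphM mulrA.
Qed.
End FiniteDimension.

Section FiniteLocal.
Variables (K : fieldType) (A : comPzRingType) (sc : {rmorphism K -> A}).
Variables (m : nat) (dimA : has_dim sc (fun _ => True) m).

(** In a^i (1 + a b) = 0 the second factor is a unit, since otherwise 1 = (1 + a b) - a b would be a
    nonunit. *)
Lemma finite_dim_nonunit_nilpotent : nonunits_add A ->
  forall a : A, nonunit a -> exists k, a ^+ k = 0.
Proof.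
move=> locA a na; have [i [N [c ac]]] := finite_dim_root dimA a.
set b := \sum_(k < N) _ in ac; exists i.
have [[d bd]|n1] := pselect (exists d, (1 + a * b) * d = 1).
  by rewrite -[a ^+ i]mulr1 -bd mulrA ac mul0r.
have : nonunit (1 : A).
  rewrite -[1](addrK (a * b)); apply: locA => //.
  by apply: nonunitN; rewrite mulrC; apply: nonunitMl.
by case; exists 1; rewrite mulr1.
Qed.

(** Multiplying a^i (1 + a d) = 0 by b^i leaves 1 + a d = 0, so - d is the inverse. *)
Lemma finite_dim_inverse_poly (a b : A) : a * b = 1 ->
  exists N (c : nat -> K), a * \sum_(k < N) sc (c k) * a ^+ k = 1.
Proof.
move=> ab; have [i [N [c ac]]] := finite_dim_root dimA a.
exists N, (fun k => - c k).
have -> : \sum_(k < N) sc (- c k) * a ^+ k = - \sum_(k < N) sc (c k) * a ^+ k.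
  by rewrite -sumrN; apply: eq_bigr => k _; rewrite rmorphN mulNr.
set d := \sum_(k < N) _ in ac *.
have /(congr1 ( *%R (b ^+ i))) := ac.
rewrite mulrA -exprMn [b * a]mulrC ab expr1n mul1r mulr0 mulrN => /eqP.
by rewrite addr_eq0 => /eqP.
Qed.
End FiniteLocal.

(** * Germs *)

Lemma tofrac_invertible (A : comPzRingType) (S : GRing.MulClosed.type A) s :
  s \in S -> exists z : loc S, tofrac S s * z = 1.
Proof.
move=> Ss; exists (\pi_(loc S) (mkpair 1 Ss)).
rewrite -[LHS]/(loc_mul _ _) -pi_loc_mul; apply/eqP/loc_eqP.
by exists 1; rewrite ?rpred1 //= !mul1r !mulr1.
Qed.

Lemma tofrac_inj_mod (A : comPzRingType) (S : GRing.MulClosed.type A) a b :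
  tofrac S a = tofrac S b -> exists2 u, u \in S & u * a = u * b.
Proof.
by move=> /eqP/loc_eqP[u Su /=]; rewrite !mulr1 => e; exists u.
Qed.

Lemma tofrac_cancel (A : comPzRingType) (S : GRing.MulClosed.type A) s
    (x y : loc S) :
  s \in S -> x * tofrac S s = y * tofrac S s -> x = y.
Proof.
move=> /tofrac_invertible[z sz] /(congr1 ( *%R^~ z)).
by rewrite -!mulrA sz !mulr1.
Qed.

Lemma add_fractions_unit (A : comPzRingType) (a b c f g h f' g' h' : A) :
    a * g = f -> b * g' = f' -> g * h = 1 -> g' * h' = 1 -> (a + b) * c = 1 ->
  (f * g' + f' * g) * (c * h * h') = 1.
Proof.
move=> <- <- gh gh' abc.
transitivity ((a + b) * c * (g * h) * (g' * h')); first by ring.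
by rewrite abc gh gh' !mulr1.
Qed.

(** * Homogeneous components of polynomials *)

Section Homogeneous.
Variables (K : fieldType) (n : nat).
Implicit Types F G : {mpoly K[n]}.

Lemma sum_pihomog F : F = \sum_(i < mmeasure mdeg F) pihomog mdeg i F.
Proof. exact: pihomog_partitionE. Qed.

Lemma pihomogMr i e F G : G \is e.-homog ->
  pihomog mdeg (i + e) (F * G) = pihomog mdeg i F * G.
Proof.
move=> hG; set N := (mmeasure mdeg F + i.+1)%N.
have FN : F = \sum_(k < N) pihomog mdeg k F.
  by apply: pihomog_partitionE; apply: leq_addr.
have iN : (i < N)%N by rewrite /N addnS ltnS leq_addl.
rewrite {1}FN mulr_suml linear_sum /= (bigD1 (Ordinal iN)) //= big1 ?addr0.
  by rewrite pihomog_dE // dhomogM // pihomogP.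
move=> k ki; apply: (@pihomog_ne0 _ _ _ (k + e)%N); last first.
  by rewrite dhomogM // pihomogP.
by rewrite eqn_add2r.
Qed.

Lemma dhomogX1 (i : 'I_n) : ('X_i : {mpoly K[n]}) \is 1.-homog.
Proof. by rewrite dhomogX /= mdeg1. Qed.

Lemma dhomogXn (i : 'I_n) k : ('X_i ^+ k : {mpoly K[n]}) \is k.-homog.
Proof. by have := dhomogMn k (dhomogX1 i); rewrite mul1n. Qed.

End Homogeneous.

(** * Local rings at points off X_0 = 0 *)

Section Germs.
Variables (K : fieldType) (n : nat) (X : subscheme K n) (p : point K n).
Hypotheses (Xp : supp X p) (p0 : 'X_ord0 \notin pt p).
Local Notation P := {mpoly K[n.+1]}.
Local Notation O := (stalk X p).
Local Notation L := (loc (off_pt (X := X) p)).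
Local Notation toL := (tofrac (off_pt (X := X) p)).
Implicit Types (F G : P) (a b c : O).

Lemma ptB F G : F \in pt p -> G \in pt p -> F - G \in pt p.
Proof.
by move=> pF pG; apply: ptD => //; rewrite -mulN1r; apply: ptM.
Qed.

Lemma pt_expn F k : F \notin pt p -> F ^+ k \notin pt p.
Proof.
move=> nF; elim: k => [|k IHk]; first by rewrite expr0 pt1.
by rewrite exprS; apply/negP => /pt_prime; rewrite (negPf nF) (negPf IHk).
Qed.

Lemma ptM_notin F G : F \notin pt p -> G \notin pt p -> F * G \notin pt p.
Proof.
by move=> nF nG; apply/negP => /pt_prime; rewrite (negPf nF) (negPf nG).
Qed.

Lemma resid_off i F : F \is i.-homog -> F \notin pt p ->
  resid X F \in off_pt (X := X) p.
Proof. by move=> hF nF; apply/asboolP; exists i, F. Qed.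

(** As I_X lies in p, one representative outside p forces all of them outside. *)
Lemma off_resid F : resid X F \in off_pt (X := X) p -> F \notin pt p.
Proof.
move=> /asboolP[i [G [_ nG /resid_eqP/Xp FG]]]; apply: contra nG => pF.
by rewrite -[G](subKr F) ptB.
Qed.

Lemma x0_off k : x0 X ^+ k \in off_pt (X := X) p.
Proof. by apply: rpredX; apply: (@resid_off 1); rewrite ?dhomogX1. Qed.

Lemma toL_x0_cancel k (x y : L) :
  x * toL (x0 X) ^+ k = y * toL (x0 X) ^+ k -> x = y.
Proof. by rewrite -rmorphXn; apply/tofrac_cancel/x0_off. Qed.

Lemma hgr_resid i F : F \is i.-homog -> hgr i (resid X F).
Proof. by move=> hF; exists F. Qed.

Lemma hgr_x0 (k : nat) : hgr k (x0 X ^+ k).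
Proof. by rewrite -rmorphXn; apply/hgr_resid/dhomogXn. Qed.

Lemma stalk_frac i F G : F \is i.-homog -> G \is i.-homog -> G \notin pt p ->
  exists a, val a * toL (resid X G) = toL (resid X F).
Proof.
move=> hF hG nG; have [z Gz] := tofrac_invertible (resid_off hG nG).
have zP : toL (resid X F) * z * toL (resid X G) = toL (resid X F).
  by rewrite -mulrA [z * _]mulrC Gz mulr1.
suff st : toL (resid X F) * z \in stalk_pred (X := X) (p := p).
  by exists (exist _ (toL (resid X F) * z) st).
apply/asboolP; exists i%:Z, i%:Z, (resid X F), (resid X G).
by split; rewrite ?add0r //; [apply: resid_off hG nG | apply: hgr_resid..].
Qed.

Lemma germ_exists i F : F \is i.-homog -> exists a, is_germ i F a.
Proof.
move=> hF; have [a aP] := stalk_frac hF (dhomogXn K ord0 i) (pt_expn i p0).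
by exists a; rewrite /is_germ -aP !rmorphXn.
Qed.

Lemma germ_inj i F a b : is_germ i F a -> is_germ i F b -> a = b.
Proof. by move=> ga gb; apply/val_inj/(@toL_x0_cancel i); rewrite ga gb. Qed.

Lemma germM i j F G a b :
  is_germ i F a -> is_germ j G b -> is_germ (i + j) (F * G) (a * b).
Proof. by rewrite /is_germ !rmorphM /= => <- <-; rewrite exprD; ring. Qed.

Lemma germD i F G a b :
  is_germ i F a -> is_germ i G b -> is_germ i (F + G) (a + b).
Proof. by rewrite /is_germ !rmorphD /= => <- <-; ring. Qed.

Lemma germ0 i : is_germ (X := X) (p := p) i 0 0.
Proof. by rewrite /is_germ !rmorph0 mul0r. Qed.

Lemma germ1 : is_germ (X := X) (p := p) 0 1 1.
Proof. by rewrite /is_germ !rmorph1 mul1r expr0. Qed.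

Lemma germ_x0 k : is_germ (X := X) (p := p) k ('X_ord0 ^+ k) 1.
Proof. by rewrite /is_germ !rmorph1 mul1r !rmorphXn. Qed.

Lemma germ_const k : is_germ (X := X) (p := p) 0 k%:MP (stalk_scal X p k).
Proof. by rewrite /is_germ expr0 mulr1. Qed.

Lemma germZ i k F a : is_germ i F a ->
  is_germ i (k%:MP * F) (stalk_scal X p k * a).
Proof. by move=> ga; apply: (germM (germ_const k)). Qed.

Lemma germX i k F a : is_germ i F a -> is_germ (i * k) (F ^+ k) (a ^+ k).
Proof.
move=> ga; elim: k => [|k IHk]; first by rewrite muln0 !expr0; apply: germ1.
by rewrite mulnS !exprS; apply: germM.
Qed.

Lemma germ_sum i (I : Type) (s : seq I) (Q : pred I) (F : I -> P) (a : I -> O) :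
    (forall k, Q k -> is_germ i (F k) (a k)) ->
  is_germ i (\sum_(k <- s | Q k) F k) (\sum_(k <- s | Q k) a k).
Proof.
move=> ga; elim/big_rec2: _ => [|k b G Qk gb]; first exact: germ0.
by apply: germD => //; apply: ga.
Qed.

Lemma germ_vanishing i F : F \in vanishing X -> is_germ (X := X) (p := p) i F 0.
Proof.
move=> IF; rewrite /is_germ (_ : resid X F = 0) ?rmorph0 ?mul0r //.
by rewrite -(rmorph0 (resid X)); apply/resid_eqP; rewrite subr0.
Qed.

Lemma stalk_repr a : exists i F G, [/\ F \is i.-homog, G \is i.-homog,
  G \notin pt p & val a * toL (resid X G) = toL (resid X F)].
Proof.
have [m [e [x [s [Ss hs hx]]]]] := asboolW (valP a).
rewrite add0r => me ex; subst m; case: e hs hx => [i|i].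
  move=> [G hG sG] [F hF xF]; subst x s; exists i, F, G.
  by split=> //; apply: off_resid Ss.
(* A denominator of negative degree would be 0, which lies in p. *)
move=> s0; have /negP[] : (0 : P) \notin pt p; last exact: pt0.
by apply: off_resid; rewrite rmorph0 -s0.
Qed.

Lemma germ_unit i F a : F \is i.-homog -> is_germ i F a -> F \notin pt p ->
  exists b, a * b = 1.
Proof.
move=> hF ga nF; have [b bP] := stalk_frac (dhomogXn K ord0 i) hF nF.
exists b; apply/val_inj/(tofrac_cancel (resid_off hF nF)).
rewrite rmorphM rmorph1 mul1r -mulrA bP -ga.
by rewrite !rmorphXn.
Qed.

(** An inverse U / G would give w X_0^i G = w U F modulo I_X for some w off p; the right side lies
    in p, the left side does not. *)
Lemma germ_nonunit i F a : is_germ i F a -> F \in pt p -> nonunit a.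
Proof.
move=> ga pF [b ab1]; have [j [U [G [hU hG nG bU]]]] := stalk_repr b.
have : toL (resid X ('X_ord0 ^+ i * G)) = toL (resid X (U * F)).
  have vab : val a * val b = 1 by rewrite -rmorphM ab1 rmorph1.
  rewrite !rmorphM !rmorphXn /= -bU -ga -[LHS]mul1r -vab; ring.
move=> /tofrac_inj_mod[w Sw]; rewrite -[w]resid_repr -!rmorphM.
move=> /resid_eqP/Xp; set w' := repr w => pw.
have /negP[] : w' * ('X_ord0 ^+ i * G) \notin pt p.
  by rewrite !ptM_notin ?pt_expn //; apply: off_resid; rewrite resid_repr.
rewrite -[X in X \in _](subrK (w' * (U * F))); apply: ptD => //.
by rewrite mulrA; apply: ptM.
Qed.

(** A nonunit fraction has its numerator in p, hence so does the sum of two such fractions, and the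
    germ of an element of p is no unit. *)
Lemma stalk_nonunits_add : nonunits_add O.
Proof.
move=> a b na nb [c abc].
have [i [F [G [hF hG nG aF]]]] := stalk_repr a.
have [j [F' [G' [hF' hG' nG' bF']]]] := stalk_repr b.
have frac k (U V : P) (x v u : O) : V \is k.-homog -> is_germ k V v ->
    is_germ k U u -> val x * toL (resid X V) = toL (resid X U) -> x * v = u.
  move=> hV gv gu e; apply/val_inj/(@toL_x0_cancel k).
  by rewrite rmorphM -mulrA gv e gu.
have [f gf] := germ_exists hF; have [g gg] := germ_exists hG.
have [f' gf'] := germ_exists hF'; have [g' gg'] := germ_exists hG'.
have afg := frac _ _ _ _ _ _ hG gg gf aF.
have bfg := frac _ _ _ _ _ _ hG' gg' gf' bF'.
have pF : F \in pt p.
  apply: contraT => nF; have [h fh] := germ_unit hF gf nF; case: na.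
  by exists (g * h); rewrite mulrA afg.
have pF' : F' \in pt p.
  apply: contraT => nF'; have [h fh] := germ_unit hF' gf' nF'; case: nb.
  by exists (g' * h); rewrite mulrA bfg.
have [h gh] := germ_unit hG gg nG; have [h' gh'] := germ_unit hG' gg' nG'.
have gs : is_germ (i + j) (F * G' + F' * G) (f * g' + f' * g).
  by apply: germD; [apply: germM | rewrite addnC; apply: germM].
apply: (germ_nonunit gs); first by apply: ptD; rewrite mulrC; apply: ptM.
exists (c * h * h').
exact: add_fractions_unit afg bfg gh gh' abc.
Qed.
End Germs.

Section Scalars.
Variables (K : fieldType) (n : nat) (X : subscheme K n).

Lemma hscal_is_zmod_morphism : zmod_morphism (hscal X).
Proof. by move=> a b; rewrite /hscal mpolyCB rmorphB. Qed.
HB.instance Definition _ := GRing.isZmodMorphism.Build K (hcoord X) (hscal X)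
  hscal_is_zmod_morphism.

Lemma hscal_is_monoid_morphism : monoid_morphism (hscal X).
Proof.
by split=> [|a b]; rewrite /hscal ?rmorph1 // mpolyCM rmorphM.
Qed.
HB.instance Definition _ := GRing.isMonoidMorphism.Build K (hcoord X) (hscal X)
  hscal_is_monoid_morphism.

Variable p : point K n.

Lemma stalk_scal_is_zmod_morphism : zmod_morphism (stalk_scal X p).
Proof. by move=> a b; apply: val_inj; rewrite rmorphB /= !rmorphB. Qed.
HB.instance Definition _ := GRing.isZmodMorphism.Build K (stalk X p)
  (stalk_scal X p) stalk_scal_is_zmod_morphism.

Lemma stalk_scal_is_monoid_morphism : monoid_morphism (stalk_scal X p).
Proof.
split=> [|a b]; apply: val_inj.
  by rewrite rmorph1 /= !rmorph1.
by rewrite rmorphM /= !rmorphM.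
Qed.
HB.instance Definition _ := GRing.isMonoidMorphism.Build K (stalk X p)
  (stalk_scal X p) stalk_scal_is_monoid_morphism.
End Scalars.

(** * Separation of points and injectivity of the germ map *)

Section ZeroDimensional.
Variables (K : fieldType) (n : nat) (X : subscheme K n).
Hypothesis X_dim0 : zero_dimensional X.
Hypothesis X_off : forall p : point K n, supp X p -> 'X_ord0 \notin pt p.
Local Notation P := {mpoly K[n.+1]}.
Implicit Types (F G h : P) (p q : point K n).

Section Separation.
Hypothesis X_fin : forall p, supp X p ->
  exists m, has_dim (stalk_scal X p) (fun _ => True) m.

Lemma stalk_nonunit_nilpotent p : supp X p ->
  forall a : stalk X p, nonunit a -> exists k, a ^+ k = 0.
Proof.
move=> Xp; have [m dim] := X_fin Xp.
by apply: (finite_dim_nonunit_nilpotent dim); apply: stalk_nonunits_add; auto.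
Qed.

(** Dimension zero gives an element of q outside p, and one of its homogeneous components is outside
    p too. The germ of that component at q is a nonunit, hence nilpotent, and primeness of p keeps
    its powers outside p. *)
Lemma separate_two_points p q : supp X p -> supp X q -> q <> p ->
  exists e h, [/\ h \is e.-homog, h \notin pt p
    & is_germ (X := X) (p := q) e h 0].
Proof.
move=> Xp Xq qp.
have [F qF nF] : exists2 F, F \in pt q & F \notin pt p.
  apply: contrapT => nqp; apply/qp/X_dim0.2 => // F qF.
  by apply: contraT => nF; case: nqp; exists F.
have [i ni] : exists i, pihomog mdeg i F \notin pt p.
  apply: contrapT => ni; case/negP: nF; rewrite [F]sum_pihomog.
  apply: (big_ind (fun f => f \in pt p)) => [||i _]; first exact: pt0.
    by move=> *; apply: ptD.
  by apply: contraT => nFi; case: ni; exists (i : nat).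
have hFi := pihomogP mdeg i F.
have [a ga] := germ_exists X (X_off Xq) hFi.
have [|k ak] := stalk_nonunit_nilpotent Xq (a := a).
  by apply: (germ_nonunit Xq (X_off Xq) ga); apply: pt_homog.
exists (i * k)%N, (pihomog mdeg i F ^+ k); split; first exact: dhomogMn.
  exact: pt_expn.
by rewrite -ak; apply: germX.
Qed.

(** A product of forms separating p from each other point, built over the first k points of the
    list. *)
Lemma separate_points s (x : 'I_s -> point K n) p :
    (forall q, supp X q <-> exists j, q = x j) -> supp X p ->
  exists e h, [/\ h \is e.-homog, h \notin pt p
    & forall q, supp X q -> q <> p -> is_germ (X := X) (p := q) e h 0].
Proof.
move=> suppE Xp.
suff H k : (k <= s)%N -> exists e h, [/\ h \is e.-homog, h \notin pt p
    & forall j : 'I_s, (j < k)%N -> x j <> p ->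
        is_germ (X := X) (p := x j) e h 0].
  have [e [h [hh nh gh]]] := H s (leqnn s); exists e, h; split=> // q.
  by move=> /suppE[j ->]; apply: gh.
elim: k => [|k IHk] ks; first by exists 0%N, 1; rewrite dhomog1 pt1.
have [e [h [hh nh gh]]] := IHk (ltnW ks).
pose q := x (Ordinal ks).
have Xq : supp X q by apply/suppE; exists (Ordinal ks).
have gM e1 e2 h1 h2 q' : supp X q' -> h1 \is e1.-homog ->
    is_germ (X := X) (p := q') e2 h2 0 ->
    is_germ (X := X) (p := q') (e1 + e2) (h1 * h2) 0.
  move=> Xq' hh1 g2; have [a ga] := germ_exists X (X_off Xq') hh1.
  by rewrite -[0](mulr0 a); apply: germM.
have [qp|qp] := pselect (q = p).
  exists e, h; split=> // j; rewrite ltnS leq_eqVlt.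
  case/orP=> [/eqP jk|]; last exact: gh.
  by have -> : j = Ordinal ks by apply: val_inj.
have [e' [h' [hh' nh' gh']]] := separate_two_points Xp Xq qp.
exists (e + e')%N, (h * h'); split; [exact: dhomogM | exact: ptM_notin |].
move=> j; rewrite ltnS leq_eqVlt => /orP[/eqP jk _|jk xj].
  have -> : j = Ordinal ks by apply: val_inj.
  exact: gM.
rewrite addnC [h * h']mulrC; apply: gM hh' (gh j jk xj).
by apply/suppE; exists j.
Qed.

(* With c = F/G and h off p vanishing at the other points, the inverse of G h in
   O_{X,p} is a polynomial in G h, which makes c = F h (G h)^-1 polynomial. *)
Lemma separated_germ_lift s (x : 'I_s -> point K n) p (c : stalk X p) :
    (forall q, supp X q <-> exists j, q = x j) -> supp X p ->
  exists N G, [/\ G \is N.-homog, is_germ N G c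
    & forall q, supp X q -> q <> p -> is_germ (X := X) (p := q) N G 0].
Proof.
move=> suppE Xp; have p0 := X_off Xp.
have [i [F [G [hF hG nG cG]]]] := stalk_repr Xp c.
have [f gf] := germ_exists X p0 hF; have [g gg] := germ_exists X p0 hG.
have cgf : c * g = f.
  by apply/val_inj/(toL_x0_cancel p0 (k := i)); rewrite rmorphM -mulrA gg cG gf.
have [e [h [hh nh gh]]] := separate_points suppE Xp.
have [y gy] := germ_exists X p0 hh.
have [z yz] : exists z, g * y * z = 1.
  apply: (germ_unit (dhomogM hG hh) (germM gg gy)).
  exact: ptM_notin.
have [m dim] := X_fin Xp; have [M [co co1]] := finite_dim_inverse_poly dim yz.
(* The degree of G h. Powers of X_0, whose germ is 1, bring all terms of the inverse polynomial to
   degree E M. *)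
pose E := (i + e)%N.
pose Q : P :=
  \sum_(k < M) (co k)%:MP * ((G * h) ^+ k * 'X_ord0 ^+ (E * (M - k))).
have degQ (k : 'I_M) : (E * k + E * (M - k) = E * M)%N.
  by rewrite -mulnDr subnKC // ltnW.
have hQ : Q \is (E * M).-homog.
  apply: rpred_sum => k _; rewrite mul_mpolyC; apply: dhomogZ.
  rewrite -(degQ k) dhomogM // ?dhomogXn //.
  by apply: dhomogMn; apply: dhomogM.
have gQ : is_germ (E * M) Q (\sum_(k < M) stalk_scal X p (co k) * (g * y) ^+ k).
  apply: germ_sum => k _; apply: germZ; rewrite -(degQ k).
  rewrite -[_ ^+ k in X in is_germ _ _ X]mulr1.
  by apply: germM; [apply/germX/germM | apply: germ_x0].
exists (i + E * M + e)%N, (F * Q * h); split.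
- by rewrite !dhomogM.
- set b := \sum_(k < M) _ in co1 gQ.
  rewrite (_ : c = f * b * y); last first.
    by rewrite -[LHS]mulr1 -co1 -cgf mulrAC !mulrA.
  by apply: germM => //; apply: germM.
move=> q Xq qp; have [a ga] := germ_exists X (X_off Xq) (dhomogM hF hQ).
by rewrite -[0](mulr0 a); apply: germM => //; apply: gh.
Qed.
End Separation.

End ZeroDimensional.

(** * Injectivity of the germ map by counting dimensions *)

Section Injectivity.
Variables (K : fieldType) (n : nat) (X : subscheme K n).
Hypothesis X_dim0 : zero_dimensional X.
Hypothesis X_off : forall p : point K n, supp X p -> 'X_ord0 \notin pt p.
Variables (D r : nat).
Hypothesis degX : has_degree X D.
Hypothesis HFX : forall i : nat, (r <= i)%N ->
  has_dim (hscal X) (hgr (X := X) i) D.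
Local Notation P := {mpoly K[n.+1]}.
Implicit Types (F G h : P) (p q : point K n).

Lemma degree_finite_dim p : supp X p ->
  exists m, has_dim (stalk_scal X p) (fun _ => True) m.
Proof.
move=> Xp; have [s [x [m [_ suppE dims _]]]] := degX.
by have [j ->] := (suppE p).1 Xp; exists (m j).
Qed.

Lemma support_enum : exists s (x : 'I_s -> point K n),
  forall q, supp X q <-> exists j, q = x j.
Proof. by have [s [x [m [_ suppE _ _]]]] := degX; exists s, x. Qed.

Definition germs_vanish i F : Prop :=
  forall q, supp X q -> is_germ (X := X) (p := q) i F 0.

(** Each basis element of each stalk lifts to a form with zero germs at the other points, and powers
    of X_0 bring all lifts to degree i. Taking germs at one point isolates the coefficients
    belonging to its basis. *)
Lemma independent_lifts_of_stalk_bases : exists N, forall i, (N <= i)%N ->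
  exists G : 'I_D -> P, (forall l, G l \is i.-homog) /\
    forall v : 'I_D -> K, germs_vanish i (\sum_l (v l)%:MP * G l) ->
      forall l, v l = 0.
Proof.
have [s [x [m [xinj suppE dims DE]]]] := degX.
have Xx j : supp X (x j) by apply/suppE; exists j.
have [e eP] : exists e : forall j, 'I_(m j) -> stalk X (x j),
    forall j (c : 'I_(m j) -> K),
      \sum_(k < m j) stalk_scal X (x j) (c k) * e j k = 0 -> forall k, c k = 0.
  have base j : {e : 'I_(m j) -> stalk X (x j) |
      forall c : 'I_(m j) -> K,
      \sum_(k < m j) stalk_scal X (x j) (c k) * e k = 0 -> forall k, c k = 0}.
    apply: cid; have [e [_ eP]] := dims j; exists e => c c0 k.
    have [c' [_ c'E]] := eP 0 I.
    have e1 : c' = [ffun k => c k].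
      by apply: c'E; rewrite -[LHS]c0; apply: eq_bigr => l _; rewrite ffunE.
    have e2 : c' = [ffun=> 0].
      by apply: c'E; rewrite big1 // => l _; rewrite ffunE rmorph0 mul0r.
    by have /ffunP/(_ k) := etrans (esym e1) e2; rewrite !ffunE.
  by exists (fun j => sval (base j)) => j; apply: (svalP (base j)).
have lift (t : {j & 'I_(m j)}) : exists NG : nat * P,
    [/\ NG.2 \is NG.1.-homog, is_germ NG.1 NG.2 (e (tag t) (tagged t))
      & forall q, supp X q -> q <> x (tag t) ->
          is_germ (X := X) (p := q) NG.1 NG.2 0].
  have [N [G [hG gG G0]]] := separated_germ_lift X_dim0 X_off degree_finite_dim
    (e (tag t) (tagged t)) suppE (Xx (tag t)).
  by exists (N, G).
have [NG NGP] := choice lift.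
exists (\max_t (NG t).1)%N => i iN.
pose G t := (NG t).2 * 'X_ord0 ^+ (i - (NG t).1).
have Ni t : ((NG t).1 + (i - (NG t).1) = i)%N.
  rewrite subnKC // (leq_trans _ iN) //.
  exact: (leq_bigmax (F := fun t => (NG t).1)).
have hG t : G t \is i.-homog.
  have [hGt _ _] := NGP t; rewrite -(Ni t).
  by apply: dhomogM => //; apply: dhomogXn.
have gG t : is_germ i (G t) (e (tag t) (tagged t)).
  have [_ gt _] := NGP t; rewrite -(Ni t) -[e _ _]mulr1.
  by apply: germM => //; apply: germ_x0.
have gG0 t q : supp X q -> q <> x (tag t) ->
    is_germ (X := X) (p := q) i (G t) 0.
  move=> Xq qt; have [_ _ g0] := NGP t; rewrite -(Ni t) -[0](mul0r 1).
  by apply: germM; [apply: g0 | apply: germ_x0].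
have cardT : #|{: {j & 'I_(m j)}}| = D.
  rewrite DE card_tagged sumnE big_map big_enum /=.
  by apply: eq_bigr => j _; rewrite card_ord.
pose T := {j & 'I_(m j)}; rewrite -cardT.
exists (fun l => G (enum_val l)); split=> [l|v v0 l]; first exact: hG.
pose w (t : T) := v (enum_rank t).
suff w0 t : w t = 0 by rewrite -[l]enum_valK; apply: w0.
pose tg_ j (k : 'I_(m j)) : T := Tagged (fun j => 'I_(m j)) k.
have tgE (t' : T) : @tg_ (tag t') (tagged t') = t' by case: t'.
have sumE : \sum_l (v l)%:MP * G (enum_val l) =
    \sum_j \sum_k (w (@tg_ j k))%:MP * G (@tg_ j k).
  rewrite (@sig_big_dep _ _ _ _ (fun j => 'I_(m j) : finType)
    predT (fun j => predT)
    (fun j k => (w (@tg_ j k))%:MP * G (@tg_ j k))) /=.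
  rewrite [RHS](reindex (@enum_val T predT)) /=; last first.
    by apply: onW_bij; apply: enum_val_bij.
  by apply: eq_bigr => l' _; rewrite tgE /w enum_valK.
case: t => j k; apply: (eP j (fun k => w (@tg_ j k))).
apply: (germ_inj (X_off (Xx j)) _ (v0 _ (Xx j))).
rewrite sumE (bigD1 j) //= -[X in is_germ _ _ X]addr0.
apply: germD; first by apply: germ_sum => k' _; apply/germZ/(gG (@tg_ j k')).
have <- : \sum_(j' < s | j' != j) (0 : stalk X (x j)) = 0 by rewrite big1.
apply: germ_sum => j' jj'.
have <- : \sum_(k' < m j') (0 : stalk X (x j)) = 0 by rewrite big1.
apply: germ_sum => k' _.
rewrite -[0](mulr0 (stalk_scal X (x j) (w (@tg_ j' k')))).
by apply: germZ; apply: gG0 => // /xinj /= /eqP; rewrite eq_sym (negPf jj').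
Qed.

(** The D lifted forms are independent in R_i, which has dimension D for i >= r, so they span it;
    vanishing germs then force all coefficients of F to be 0. *)
Lemma germs_vanish_large_degree : exists N, forall i F, (N <= i)%N ->
  F \is i.-homog -> germs_vanish i F -> F \in vanishing X.
Proof.
have [N NP] := independent_lifts_of_stalk_bases.
exists (maxn N r) => i F; rewrite geq_max => /andP[/NP[G [hG indG]] ri] hF F0.
have [b [_ bP]] := HFX ri.
have coord y : hgr (X := X) i y ->
    exists c : 'rV[K]_D, y = \sum_k hscal X (c 0 k) * b k.
  move=> /bP[c [-> _]]; exists (\row_k c k).
  by apply: eq_bigr => k _; rewrite mxE.
have [c cP] := choice (fun l => coord _ (hgr_resid X (hG l))).
have [u uP] := coord _ (hgr_resid X hF).
pose M := \matrix_l c l.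
have comb (v : 'rV_D) : resid X (\sum_l (v 0 l)%:MP * G l) =
    \sum_k hscal X ((v *m M) 0 k) * b k.
  rewrite rmorph_sum /=.
  transitivity (\sum_l \sum_k hscal X (v 0 l * M l k) * b k).
    apply: eq_bigr => l _; rewrite rmorphM /= cP mulr_sumr.
    apply: eq_bigr => k _.
    by rewrite !mxE rmorphM mulrA.
  rewrite exchange_big; apply: eq_bigr => k _ /=.
  by rewrite mxE rmorph_sum mulr_suml.
have vanE F1 F2 :
    resid X F1 = resid X F2 -> germs_vanish i F1 -> germs_vanish i F2.
  by move=> e g q Xq; rewrite /is_germ -e; apply: g.
have Mfree : row_free M.
  rewrite -kermx_eq0; apply/rowV0P => v /sub_kermxP vM.
  apply/rowP => l; rewrite mxE; apply: (indG (fun l => v 0 l)).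
  apply: (vanE 0); last by move=> q _; apply: germ0.
  by rewrite rmorph0 comb vM big1 // => k _; rewrite mxE rmorph0 mul0r.
pose v := u *m invmx M.
have vM : v *m M = u by rewrite /v mulmxKV // -row_free_unit.
have FE : resid X F = resid X (\sum_l (v 0 l)%:MP * G l) by rewrite comb vM uP.
have v0 := indG _ (vanE _ _ FE F0).
rewrite -[F]subr0; apply/resid_eqP; rewrite FE; congr (resid X _).
by rewrite big1 // => l _; rewrite v0 mpolyC0 mul0r.
Qed.

(** Multiplication by the monomials of degree N reaches the degrees where germs detect vanishing;
    saturation then brings F itself into the ideal. *)
Lemma germs_vanish_vanishing i F :
  F \is i.-homog -> germs_vanish i F -> F \in vanishing X.
Proof.
move=> hF F0; have [N NP] := germs_vanish_large_degree.
apply: vanishing_saturated; exists N => m mN.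
have hm : ('X_[m] : P) \is N.-homog by rewrite dhomogX; apply/eqP.
apply: (NP (N + i)%N); [exact: leq_addr | exact: dhomogM | move=> q Xq].
have [a ga] := germ_exists X (X_off Xq) hm.
by rewrite -[0](mulr0 a); apply: germM ga (F0 q Xq).
Qed.

(** The germ of X_0 is 1, so X_0 F_i in I_X makes all germs of the component F_i vanish. *)
Lemma x0_nonzerodivisor : nonzerodivisor (x0 X).
Proof.
move=> y; rewrite -[y]resid_repr -rmorphM -(rmorph0 (resid X)).
set F := repr y => /resid_eqP; rewrite subr0 mulrC => FI.
apply/resid_eqP; rewrite subr0 [F]sum_pihomog.
apply: (big_ind (fun f => f \in vanishing X)) => [||i _].
- exact: vanishing0.
- by move=> *; apply: vanishingD.
have hFi := pihomogP mdeg i F.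
apply: (germs_vanish_vanishing hFi) => q Xq.
have [a ga] := germ_exists X (X_off Xq) hFi.
have g1 : is_germ (i + 1) (pihomog mdeg i F * 'X_ord0) (a * 1).
  by apply: germM ga _; have := germ_x0 X q 1; rewrite expr1.
suff <- : a * 1 = 0 by rewrite mulr1.
apply: (germ_inj (X_off Xq) g1); apply: germ_vanishing.
by rewrite -(pihomogMr i F (dhomogX1 K ord0)); apply: vanishing_homog.
Qed.
End Injectivity.

(** * The complementary module and the different *)

Section Complementary.
Variables (K : fieldType) (n : nat) (X : subscheme K n).
Hypothesis x0_nzd : nonzerodivisor (x0 X).
Local Notation P := {mpoly K[n.+1]}.
Local Notation R := (hcoord X).
Implicit Types (x y s : R).

Lemma toQ_inj : injective (toQh X).
Proof.
move=> x y /tofrac_inj_mod[u /asboolP[_ nu] e]; apply/eqP.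
by rewrite -subr_eq0; apply/eqP/nu; rewrite mulrBr e subrr.
Qed.

Lemma x0_hnzd N : x0 X ^+ N \in hnzd (X := X).
Proof.
apply/asboolP; split; first by exists N; apply: hgr_x0.
elim: N => [|N IHN] y; first by rewrite expr0 mul1r.
by rewrite exprS -mulrA => /x0_nzd/IHN.
Qed.

(** Comparing components of degree d + e in F S = A modulo I_X, where F represents y, gives s y = s
    F_d in R, and s cancels. *)
Lemma hgr_divide (d : nat) e s y :
  s \in hnzd (X := X) -> hgr e s -> hgr (d%:Z + e) (y * s) -> hgr d y.
Proof.
move=> /asboolP[_ nz]; case: e => [e|e]; last first.
  move=> /= s0; rewrite s0 in nz; rewrite (nz y) ?mul0r //.
  move=> _; exact: (hgr0 X d).
rewrite -PoszD => -[S hS sS] [A hA yA]; exists (pihomog mdeg d (repr y)).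
  exact: pihomogP.
set F := repr y; apply/eqP; rewrite -subr_eq0; apply/eqP/nz.
have FSA : F * S - A \in vanishing X.
  by apply/resid_eqP; rewrite rmorphM /= resid_repr -sS.
have := vanishing_homog FSA (d + e)%N.
rewrite linearB /= (pihomogMr _ _ hS) (pihomog_dE hA) => /resid_eqP.
rewrite rmorphM /= -yA -sS => e1.
by rewrite mulrBr [s * resid _ _]mulrC e1 mulrC subrr.
Qed.

Lemma Qgr_toQ (d : nat) y : Qgr d (toQh X y) -> hgr d y.
Proof.
move=> [m [e [a [s [Ss hs ha em ys]]]]]; rewrite em in ha.
apply: (hgr_divide Ss hs); suff -> : y * s = a by [].
by apply: toQ_inj; rewrite rmorphM.
Qed.

(** Lifting to polynomials and taking the component of degree i modulo I_X leaves a single monomial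
    in X_0 or 0. *)
Lemma Kx0_homog (i : nat) y : in_Kx0 y -> hgr i y ->
  exists c, y = hscal X c * x0 X ^+ i.
Proof.
move=> [m [c yc]] [W hW yW].
pose V : P := \sum_(k < m) (c k)%:MP * 'X_ord0 ^+ k.
have resid_monomial k :
    resid X ((c k)%:MP * 'X_ord0 ^+ k) = hscal X (c k) * x0 X ^+ k.
  by rewrite rmorphM rmorphXn.
have yV : y = resid X V.
  by rewrite yc rmorph_sum; apply: eq_bigr => k _; rewrite -resid_monomial.
have VW : V - W \in vanishing X by apply/resid_eqP; rewrite -yV.
have hV k : ((c k)%:MP * 'X_ord0 ^+ k : P) \is k.-homog.
  by rewrite mul_mpolyC; apply/dhomogZ/dhomogXn.
have := vanishing_homog VW i; rewrite linearB /= (pihomog_dE hW) => /resid_eqP.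
rewrite -yW linear_sum /=; case: (ltnP i m) => im <-.
  exists (c i); rewrite (bigD1 (Ordinal im)) //= big1 ?addr0.
    by rewrite (pihomog_dE (hV i)) resid_monomial.
  by move=> k ki; apply: pihomog_ne0 (hV k).
exists 0; rewrite rmorph0 mul0r big1 ?rmorph0 // => k _.
by apply: pihomog_ne0 (hV k); rewrite ltn_eqF // (leq_trans _ im).
Qed.

(** Multiplying by x_0^e lands in K[x_0] in degree i + e, where homogeneous elements are monomials;
    x_0^e then cancels. *)
Lemma L0_homog (i : nat) l : in_L0 l -> Qgr (X := X) i l ->
  exists c, l = toQh X (hscal X c * x0 X ^+ i).
Proof.
move=> [e [y [Ky ly]]] [m [e' [a [s [Ss hs ha em ls]]]]].
have ys : y * s = a * x0 X ^+ e.
  apply: toQ_inj; rewrite !rmorphM rmorphXn /= -ly -ls.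
  by rewrite -!mulrA [toQh X s * _]mulrC.
have hy : hgr (i + e)%N y.
  apply: (hgr_divide Ss hs); rewrite ys PoszD addrAC -em.
  by apply: hgrM => //; apply: hgr_x0.
have [c yE] := Kx0_homog Ky hy; exists c.
apply: (tofrac_cancel (x0_hnzd e)); rewrite rmorphXn ly yE exprD.
by rewrite !rmorphM /= mulrA !rmorphXn.
Qed.

Variable sigma : Qh X -> Qh X.
Hypotheses (sigma_lin : lin_over (in_L0 (X := X)) sigma)
  (sigma_deg : of_degree (Qgr (X := X)) 0 sigma).

Lemma Kx0_L0 y : in_Kx0 y -> in_L0 (toQh X y).
Proof. by move=> Ky; exists 0%N, y; rewrite expr0 mulr1. Qed.

(* A degree 0 element b maps R into elements whose traces have degree >= 0, and
   the elements of L_0 of nonnegative degree are polynomials in x_0. *)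
Lemma degree0_complementary N (G : P) b : G \is N.-homog ->
  b * toQh X (x0 X ^+ N) = toQh X (resid X G) -> complementary_module sigma b.
Proof.
move=> hG bG; have [sL0 sD sZ] := sigma_lin.
have s0 : sigma 0 = 0.
  by apply: (@addrI _ (sigma 0)); rewrite -sD !addr0.
have trE (i : nat) x : hgr i x ->
    exists c, sigma (b * toQh X x) = toQh X (hscal X c * x0 X ^+ i).
  move=> hx; apply: L0_homog => //; rewrite -[i%:Z]add0r; apply: sigma_deg.
  (* The fraction b x = (G x) / x_0^N has degree i. *)
  exists (N + i)%N, N, (resid X G * x), (x0 X ^+ N); split.
  - exact: x0_hnzd.
  - exact: hgr_x0.
  - by rewrite PoszD; apply: hgrM => //; apply: hgr_resid.
  - by rewrite PoszD addrC.
  by rewrite mulrAC bG rmorphM.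
have ex x : exists y, in_Kx0 y /\ toQh X y = sigma (b * toQh X x).
  have comp (i : nat) := trE i _ (hgr_resid X (pihomogP mdeg i (repr x))).
  have [c cP] := choice comp.
  exists (\sum_(i < mmeasure mdeg (repr x)) hscal X (c i) * x0 X ^+ i); split.
    by exists (mmeasure mdeg (repr x)), c.
  rewrite -[x in RHS]resid_repr [in RHS](sum_pihomog (repr x)).
  rewrite !rmorph_sum /= mulr_sumr.
  rewrite (big_morph sigma sD s0); apply: eq_bigr => i _.
  by rewrite cP.
have [phi phiP] := choice ex.
have phiE x : toQh X (phi x) = sigma (b * toQh X x) by case: (phiP x).
exists phi; split; last first.
  by move=> x l Ll; rewrite phiE mulrA [_ * l]mulrC sZ // mulrC.
(* [phi] is itself homogeneous of degree 0, so one summand suffices. *)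
exists 1%N, (fun _ => phi), (fun _ => 0); split; last first.
  by move=> x; rewrite big_ord1.
move=> _; split; first split.
- by move=> x; case: (phiP x).
- by move=> x y; apply: toQ_inj; rewrite rmorphD /= !phiE rmorphD mulrDr sD.
- move=> l x Kl; apply: toQ_inj; rewrite rmorphM /= !phiE rmorphM mulrCA.
  by rewrite sZ //; apply: Kx0_L0.
move=> [j|j] x hx; last first.
  have -> : x = 0 := hx; rewrite (_ : phi 0 = 0); first exact: hgr0.
  by apply: toQ_inj; rewrite phiE !rmorph0 mulr0.
have [c cE] := trE _ _ hx; rewrite (_ : phi x = hscal X c * x0 X ^+ j).
  by apply: hgrM; [apply: hgr_scal | apply: hgr_x0].
by apply: toQ_inj; rewrite phiE.
Qed.
End Complementary.

Lemma least_le (Q : nat -> Prop) m : Q m -> (least Q <= m)%N.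
Proof.
move=> Qm; rewrite /least; case: pselect => // h.
by case: ex_minnP => k _; apply; apply/asboolP.
Qed.

(** On an empty predicate [least] is 0, so a positive value is attained. *)
Lemma leastP (Q : nat -> Prop) : (0 < least Q)%N -> Q (least Q).
Proof.
by rewrite /least; case: pselect => // h _; case: ex_minnP => k /asboolP.
Qed.

Lemma is_germ_itilde (K : fieldType) n (X : subscheme K n) (p : point K n) d
    (a : stalk X p) (G : {mpoly K[n.+1]}) :
    G \is d.-homog -> is_germ d G a ->
    (forall q, supp X q -> q <> p -> is_germ (X := X) (p := q) d G 0) ->
  in_itilde_image d a.
Proof.
move=> hG ga g0; exists G; split; first by rewrite pihomog_dE.
move=> q m Xq qm; have [md|md] := eqVneq m d.
  by rewrite md pihomog_dE //; apply: g0 => //; case: qm => // /(_ md).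
by rewrite (@pihomog_ne0 _ _ _ d) // 1?eq_sym //; apply: germ0.
Qed.

(** * Elements of the Dedekind different *)

Section Different.
Variables (K : fieldType) (n : nat) (X : subscheme K n).
Hypothesis X_dim0 : zero_dimensional X.
Hypothesis X_off : forall p : point K n, supp X p -> 'X_ord0 \notin pt p.
Variables (D r : nat).
Hypothesis degX : has_degree X D.
Hypothesis HFX : forall i : nat, (r <= i)%N ->
  has_dim (hscal X) (hgr (X := X) i) D.
Variable sigma : Qh X -> Qh X.
Hypothesis sigma_lin : lin_over (in_L0 (X := X)) sigma.
Hypothesis sigma_deg : of_degree (Qgr (X := X)) 0 sigma.
Local Notation P := {mpoly K[n.+1]}.

Let x0_nzd : nonzerodivisor (x0 X) := x0_nonzerodivisor X_dim0 X_off degX HFX.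

(** The element 1 has degree 0 and lies in the complementary module, so f = f 1 lies in R. *)
Lemma different_sub_coord (d : nat) f : different sigma f -> Qgr (X := X) d f ->
  exists2 F : P, F \is d.-homog & f = toQh X (resid X F).
Proof.
move=> df hf; have [|y fy] := df 1.
  apply: (degree0_complementary x0_nzd sigma_lin sigma_deg (N := 0) (G := 1)).
    exact: dhomog1.
  by rewrite expr0 mul1r !rmorph1.
rewrite mulr1 in fy; rewrite fy in hf *.
by have [F hF ->] := Qgr_toQ hf; exists F.
Qed.

(** The degree 0 fraction b = G / x_0^N, with germ c at p and 0 elsewhere, lies in the complementary
    module, so f b lies in R; a form H of degree d representing it has germ c a at p and 0
    elsewhere. *)
Lemma different_germ_multiple (d : nat) (F : P) p (a c : stalk X p) :
    F \is d.-homog -> different sigma (toQh X (resid X F)) -> supp X p ->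
    is_germ d F a ->
  in_itilde_image d (c * a).
Proof.
move=> hF dF Xp ga.
have [s [x suppE]] := support_enum degX.
have [N [G [hG gG G0]]] :=
  separated_germ_lift X_dim0 X_off (degree_finite_dim degX) c suppE Xp.
have [z zx] := tofrac_invertible (x0_hnzd x0_nzd N).
pose b := toQh X (resid X G) * z.
have bG : b * toQh X (x0 X ^+ N) = toQh X (resid X G).
  by rewrite /b -mulrA [z * _]mulrC zx mulr1.
have [y Fby] := dF b (degree0_complementary x0_nzd sigma_lin sigma_deg hG bG).
have yE : y * x0 X ^+ N = resid X (F * G).
  apply: (toQ_inj (X := X)).
  by rewrite rmorphM /= -Fby -mulrA bG rmorphM /= rmorphM.
have [H hH yH] : hgr d y.
  apply: (hgr_divide (x0_hnzd x0_nzd N) (hgr_x0 X N)); rewrite yE.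
  by rewrite -PoszD; apply: hgr_resid; apply: dhomogM.
have HFG : resid X (H * 'X_ord0 ^+ N) = resid X (F * G).
  by rewrite rmorphM rmorphXn /= -yH.
(* H X_0^N and F G agree in R and X_0 has germ 1, so germs of H are products of germs of F and G. *)
have gH q (u v : stalk X q) : supp X q -> is_germ d F u -> is_germ N G v ->
    is_germ d H (u * v).
  move=> Xq gu gv; have [w gw] := germ_exists X (X_off Xq) hH.
  suff <- : w * 1 = u * v by rewrite mulr1.
  apply: (germ_inj (X_off Xq) (germM gw (germ_x0 X q N))).
  by rewrite /is_germ HFG; apply: (germM gu gv).
apply: (is_germ_itilde hH); first by rewrite mulrC; apply: gH.
move=> q Xq qp; have [u gu] := germ_exists X (X_off Xq) hF.
by rewrite -[0](mulr0 u); apply: gH => //; apply: G0.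
Qed.
End Different.

Theorem corollary5p9 (K : fieldType) (n : nat) (X : subscheme K n)
  (X_dim0 : zero_dimensional X)
  (X_gor : locally_gorenstein X)
  (X_off : forall p : point K n, supp X p -> 'X_ord0 \notin pt p)
  (r d : nat) (r_reg : is_regularity_index X r) (lt_d_r : (d < r)%N)
  (sigma : Qh X -> Qh X) (sigma_trace : is_trace_map sigma)
  (X_CBP : CBP X d) :
  has_HF_different sigma d%:Z 0.
Proof.
have [D [degX [HFX _]]] := r_reg.
have [sigma_lin sigma_deg _] := sigma_trace.
suff f0 f : different sigma f -> Qgr (X := X) d f -> f = 0.
  exists (fun _ => 0); split=> [[]//|f [df hf]]; exists [ffun=> 0].
  split=> [|c _]; first by rewrite big_ord0; apply: f0.
  by apply/ffunP => -[].
move=> df hf.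
have [F hF fF] :=
  different_sub_coord X_dim0 X_off degX HFX sigma_lin sigma_deg df hf.
rewrite fF in df *.
suff /resid_eqP : F - 0 \in vanishing X by move=> ->; rewrite !rmorph0.
rewrite subr0; apply: (germs_vanish_vanishing X_dim0 X_off degX HFX hF) => p Xp.
have [a ga] := germ_exists X (X_off p Xp) hF.
have [<- //|a0] := pselect (a = 0).
have locO := stalk_nonunits_add Xp (X_off p Xp).
have nilO := stalk_nonunit_nilpotent X_off (degree_finite_dim degX) Xp.
have gorO := X_gor p Xp.
(* With J = 0 this yields a nonzero socle element b a of the stalk. *)
have [b [ba0 mba]] := relative_socle_exists locO gorO.1 nilO (@zero_ideal _) a0.
have dp := X_CBP p Xp.
(* By CBP the minimum [deg_pt] is positive, hence attained by some Y with socle generator s. *)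
have [Y _ [m [e [s [_ [s0 ms] _ degE]]]]] :=
  leastP (leq_ltn_trans (leq0n d) dp).
move: dp; rewrite /deg_pt degE ltnNge => /negP[].
apply/bigmax_leqP => k _; apply: least_le.
(* The Gorenstein property gives s = c b a, so each e_k s is a multiple of the germ a and its [mu]
   is at most d. *)
have [c ->] := gorenstein_socle_sub locO nilO gorO ba0 mba (t := s) ms.
rewrite !mulrA.
exact: (different_germ_multiple X_dim0 X_off degX HFX sigma_lin sigma_deg _
  hF df Xp ga).
Qed.
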